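(* Consider the work-conserving max-weight scheduler with the simplex rate region $\mathcal{R}_s=\{\mathbf{r}\in\mathbb{R}_+^K:\sum_{k=1}^K r^k/C^k\le1\}$ and arrival processes with i.i.d. increments with rate vector $\boldsymbol{\mu}\in\mathrm{int}(\mathcal{R}_s)$. For $t\in\mathbb{N}$ and $\mathbf{b}\in\mathbb{R}_+^K$ let $$I_t(\mathbf{b})=\inf\{I^\sharp_t(\mathbf{x}):\mathbf{x}\in\mathbb{R}_+^{K\times t},\ \mathbf{b}\in{}^{\mathbf{x}}G^{\mathrm{wc}}_t\},\qquad J(\mathbf{b})=\inf\{I^\sharp(\mathbf{a}):\mathbf{a}\in\mathcal{D}^K_{\boldsymbol{\mu}},\ \mathbf{b}\in{}^{\mathbf{a}}G^{\mathrm{wc}}\}$$ be the finite-horizon and infinite-horizon rate functions. Then for all $\mathbf{b}\in\mathbb{R}_+^K$, $$J(\mathbf{b})=\inf_{t\ge1}I_t(\mathbf{b}).$$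
   Context: Conventions: $\mathbb{N}=\{1,2,\dots\}$, $K\in\mathbb{N}$, $C^1,\dots,C^K>0$ (also written $C_k$), $[\mathbf{x}]^+=\max\{\mathbf{0},\mathbf{x}\}$ coordinatewise; $\mathrm{int}(B):=\{\boldsymbol{\lambda}\in B:\exists\boldsymbol{\lambda}'\in B,\ \boldsymbol{\lambda}<\boldsymbol{\lambda}'\text{ coordinatewise}\}$; $\mathrm{Proj}$ is (Euclidean) projection. I.i.d. increments: for each $L\in\mathbb{N}$ and each queue $k$, $A^{k,L}=(A^{k,L}_t,t\in\mathbb{N})$ is an i.i.d. sequence of $\mathbb{R}_+$-valued variables, with expected rate $\mu^k$, independent across $k$. For each $k$ the sequence $\{A^{k,L}_1\}_L$ satisfies the conditions of the Gärtner–Ellis theorem (the limit $\Lambda_1^k(\theta):=\lim_{L\to\infty}\frac1L\log E e^{\theta LA_1^{k,L}}$ exists in $(-\infty,\infty]$ for all $\theta\in\mathbb{R}$, is finite near $0$, and is essentially smooth and lower semicontinuous), and its Fenchel–Legendre transform $\Lambda_1^{*,k}(x)=\sup_\theta(\theta x-\Lambda_1^k(\theta))$ either has domain $\mathbb{R}_+$ or is coercive (for every $y\in\mathbb{R}_+$ there is a compact set $\mathcal{C}\subsetneq\mathrm{Dom}(\Lambda_1^{*,k}):=\{x:\Lambda_1^{*,k}(x)<\infty\}$ with $\Lambda_1^{*,k}>y$ on $\mathrm{Dom}(\Lambda_1^{*,k})\setminus\mathcal{C}$). The rate functions of the arrivals are then $I^\sharp_t(\mathbf{x})=\sum_{k=1}^K\sum_{i=1}^t\Lambda_1^{*,k}(x_i^k)$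 for $\mathbf{x}\in\mathbb{R}_+^{K\times t}$ and $I^\sharp(\mathbf{a})=\sum_{k=1}^K\sum_{i=1}^\infty\Lambda_1^{*,k}(a_i^k)$ for $\mathbf{a}\in\mathcal{D}^K_{\boldsymbol{\mu}}$. Quasi-continuity: $F:\mathcal{X}\to\mathcal{Y}$ between complete metric spaces is quasi-continuous if for each $x$ there is $x_n\to x$ with $F(x_n)\to F(x)$ and $F$ continuous at every $x_n$. Cluster set: ${}^{x}F:=\{y\in\mathcal{Y}:\exists\,x_n\to x\text{ in }\mathcal{X}\text{ with }F(x_n)\to y\}$. Scheduler and workload: fixed are quasi-continuous functions $H,H^{\mathrm{wc}}:\mathbb{R}_+^K\to\mathcal{R}_s$ with $H(\mathbf{w})\in\arg\max_{\mathbf{R}\in\mathcal{R}_s}\langle\mathbf{R},\mathbf{w}\rangle$, $H^{\mathrm{wc}}(\mathbf{w})=\mathrm{Proj}_{\mathcal{R}_s}(\mathbf{w})$ if $\mathbf{w}\in\prod_{k=1}^K[0,C_k)$ and $H^{\mathrm{wc}}(\mathbf{w})=H(\mathbf{w})$ otherwise. For arrivals $(\mathbf{a}_s)_{s\in\mathbb{N}}$ ($\mathbf{a}_s\in\mathbb{R}_+^K$ arriving at time $-s$), the workload started from $\mathbf{W}_T=\mathbf{0}$ at time $-T$ evolves by $\mathbf{W}_{s-1}=[\mathbf{W}_s-H^{\mathrm{wc}}(\mathbf{W}_s)]^++\mathbf{a}_s$, $s=T,\dots,1$. With $\mathbf{a}|_{(m_1,m_2]}=(\mathbf{a}_{m_1+1},\dots,\mathbf{a}_{m_2})$,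 $G^{\mathrm{wc}}_T(\mathbf{a}|_{(0,T]}):=\mathbf{W}_0$, and $G^{\mathrm{wc}}(\mathbf{a}):=\lim_{T\to\infty}G^{\mathrm{wc}}_T(\mathbf{a}|_{(0,T]})$ (the limit is assumed to exist). Sample-path space: $\mathcal{D}$ is the set of $x:\mathbb{N}\to\mathbb{R}_+$ with $\|x\|_u:=\sup_{t}|x(0,t]/t|<\infty$, $x(0,t]=\sum_{s=1}^tx_s$, with metric $\|x-y\|_u=\sup_t|(x(0,t]-y(0,t])/t|$ (scaled uniform topology); $\mathcal{D}_\mu:=\{x\in\mathcal{D}:\lim_tx(0,t]/t=\mu\}$; $\mathcal{D}^K_{\boldsymbol{\mu}}:=\prod_k\mathcal{D}_{\mu^k}$ with the product topology. *)

(* Defs.v *)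
From HB Require Import structures.
From mathcomp Require Import all_boot all_order all_algebra.
From mathcomp Require Import all_classical all_reals all_analysis.

Set Implicit Arguments.
Unset Strict Implicit.
Unset Printing Implicit Defensive.

Import Order.TTheory GRing.Theory Num.Theory.
Import numFieldNormedType.Exports.

Local Open Scope classical_set_scope.
Local Open Scope ring_scope.

(* Indices ranging over {1, 2, ...} are shifted to start at 0: the entry of
   index i of a sequence of arrivals is the amount arriving at time -(i+1), and
   the scaling parameter of index L is L+1.  Vectors indexed by the K queues are
   columns 'cV[R]_K, so that the columns of a K x t matrix are vectors. *)

Section probability.
Context {R : realType}.
Local Open Scope ereal_scope.

Definition mutually_independent {d} {T : measurableType d}
    (P : probability T R) {I : eqType} (X : I -> {RV P >-> R}) : Prop :=
  forall (s : seq I) (B : I -> set R), uniq s ->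
    (forall i, measurable (B i)) ->
    P (\bigcap_(i in [set` s]) (X i @^-1` B i)) =
    \prod_(i <- s) P (X i @^-1` B i).

Definition identically_distributed {d} {T : measurableType d}
    (P : probability T R) (X Y : {RV P >-> R}) : Prop :=
  forall B : set R, measurable B -> P (X @^-1` B) = P (Y @^-1` B).

(* Joint independence over (k, t) expresses both the independence of the
   increments of each queue and the independence across queues. *)
Definition iid_arrivals {d} {T : measurableType d} (P : probability T R)
    {K : nat} (mu : 'cV[R]_K) (A : 'I_K -> nat -> {RV P >-> R}) : Prop :=
  [/\ forall k t w, (0 <= A k t w)%R,
      mutually_independent (fun kt : 'I_K * nat => A kt.1 kt.2),
      forall k t, identically_distributed (A k t) (A k 0%N)
    & forall k, 'E_P[A k 0%N] = (mu k ord0)%:E].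

(* L^-1 * log E exp (theta * L * X) for the scaling parameter L.+1. *)
Definition scaled_cgf {d} {T : measurableType d} (P : probability T R)
    (L : nat) (X : {RV P >-> R}) (theta : R) : \bar R :=
  (L.+1%:R^-1)%:E * lne ('E_P[fun w => expR (theta * L.+1%:R * X w)]).

Definition edom (f : R -> \bar R) : set R := [set x | f x < +oo].

Definition essentially_smooth (f : R -> \bar R) : Prop :=
  [/\ (edom f)° !=set0,
      forall x, (edom f)° x -> derivable (fine \o f) x 1%R
    & forall (u : nat -> R) (x : R), (forall n, (edom f)° (u n)) ->
        closure (edom f)° x -> ~ (edom f)° x -> u @ \oo --> x ->
        (fun n => `|(fine \o f)^`()%classic (u n)|%:E) @ \oo --> +oo].

(* Lambda is the limiting cumulant generating function of the sequence X. *)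
Definition gartner_ellis {d : nat -> measure_display}
    {T : forall L, measurableType (d L)} (P : forall L, probability (T L) R)
    (X : forall L, {RV P L >-> R}) (Lambda : R -> \bar R) : Prop :=
  [/\ forall theta, -oo < Lambda theta /\
        (fun L => scaled_cgf L (X L) theta) @ \oo --> Lambda theta,
      \forall theta \near 0%R, Lambda theta \is a fin_num,
      essentially_smooth Lambda
    & lower_semicontinuous Lambda].

Definition fenchel_legendre (Lambda : R -> \bar R) (x : R) : \bar R :=
  ereal_sup [set (theta * x)%:E - Lambda theta | theta in [set: R]].

Definition coercive (f : R -> \bar R) : Prop :=
  forall y : R, (0 <= y)%R -> exists C : set R,
    [/\ compact C, C `<` edom f & forall x, (edom f `\` C) x -> y%:E < f x].

End probability.

Section queues.
Context {R : realType} {K : nat}.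
Implicit Types (w r b mu : 'cV[R]_K) (C : 'I_K -> R).

Definition nonneg {t : nat} : set 'M[R]_(K, t) :=
  [set x | forall k i, 0 <= x k i].

Definition simplex C : set 'cV[R]_K :=
  [set r | nonneg r /\ \sum_k r k ord0 / C k <= 1].

(* The order-theoretic interior int(B), not the topological one. *)
Definition order_int (B : set 'cV[R]_K) : set 'cV[R]_K :=
  [set l | B l /\ exists2 l', B l' & forall k, l k ord0 < l' k ord0].

Definition inner r w : R := \sum_k r k ord0 * w k ord0.

Definition eucl_norm w : R := Num.sqrt (\sum_k w k ord0 ^+ 2).

Definition is_proj (B : set 'cV[R]_K) w r : Prop :=
  B r /\ forall s, B s -> eucl_norm (w - r) <= eucl_norm (w - s).

Definition is_argmax (B : set 'cV[R]_K) w r : Prop :=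
  B r /\ forall s, B s -> inner s w <= inner r w.

(* F is considered as a function on the metric subspace X. *)
Definition quasi_continuous {T U : topologicalType} (X : set T) (F : T -> U) :
    Prop :=
  forall x, X x -> exists u : nat -> T,
    [/\ forall n, X (u n), u @ \oo --> x, (F \o u) @ \oo --> F x
      & forall n, F y @[y --> within X (nbhs (u n))] --> F (u n)].

Definition max_weight C (H : 'cV[R]_K -> 'cV[R]_K) : Prop :=
  quasi_continuous nonneg H /\
  forall w, nonneg w -> is_argmax (simplex C) w (H w).

Definition work_conserving C (H Hwc : 'cV[R]_K -> 'cV[R]_K) : Prop :=
  quasi_continuous nonneg Hwc /\
  forall w, nonneg w ->
    ((forall k, w k ord0 < C k) -> is_proj (simplex C) w (Hwc w)) /\
    (~ (forall k, w k ord0 < C k) -> Hwc w = H w).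

Definition pos_part w : 'cV[R]_K := map_mx (Num.max 0) w.

(* The fold starts from W_t = 0 and incorporates the last column of x, the
   oldest arrival, first. *)
Definition G_fin (Hwc : 'cV[R]_K -> 'cV[R]_K) {t : nat} (x : 'M[R]_(K, t)) :
    'cV[R]_K :=
  foldr (fun i w => pos_part (w - Hwc w) + col i x) 0 (enum 'I_t).

Definition recent (t : nat) (a : 'I_K -> nat -> R) : 'M[R]_(K, t) :=
  \matrix_(k < K, i < t) a k i.

Definition G_inf (Hwc : 'cV[R]_K -> 'cV[R]_K) (a : 'I_K -> nat -> R) :
    'cV[R]_K :=
  limn (fun t => G_fin Hwc (recent t a)).

Definition average (x : nat -> R) (t : nat) : R :=
  (\sum_(i < t.+1) x i) / t.+1%:R.

Definition scaled_norm (x : nat -> R) : \bar R :=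
  ereal_sup [set `|average x t|%:E | t in [set: nat]].

Definition D_space (m : R) : set (nat -> R) :=
  [set x | [/\ forall i, 0 <= x i, (scaled_norm x < +oo)%E
             & average x @ \oo --> m]].

Definition DK_space mu : set ('I_K -> nat -> R) :=
  [set a | forall k, D_space (mu k ord0) (a k)].

(* Convergence in the product of the scaled uniform topologies. *)
Definition DK_cvg (u : nat -> 'I_K -> nat -> R) (a : 'I_K -> nat -> R) : Prop :=
  forall k, (fun n => scaled_norm (u n k \- a k)) @ \oo --> 0%E.

(* Cluster set at x of F as a function on X, for the sequential convergence
   cv. *)
Definition cluster_set {T : Type} {U : topologicalType} (X : set T)
    (cv : (nat -> T) -> T -> Prop) (F : T -> U) (x : T) : set U :=
  [set y | exists u : nat -> T,
     [/\ forall n, X (u n), cv u x & (F \o u) @ \oo --> y]].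

Local Open Scope ereal_scope.

Definition Isharp_fin (Ls : 'I_K -> R -> \bar R) {t : nat}
    (x : 'M[R]_(K, t)) : \bar R :=
  \sum_(k < K) \sum_(i < t) Ls k (x k i).

Definition Isharp_inf (Ls : 'I_K -> R -> \bar R) (a : 'I_K -> nat -> R) :
    \bar R :=
  \sum_(k < K) \sum_(0 <= i <oo) Ls k (a k i).

Definition I_rate (Ls : 'I_K -> R -> \bar R) (Hwc : 'cV[R]_K -> 'cV[R]_K)
    (t : nat) b : \bar R :=
  ereal_inf [set Isharp_fin Ls x | x in
    [set x : 'M[R]_(K, t) | nonneg x /\
       cluster_set nonneg (fun u y => u @ \oo --> y) (G_fin Hwc) x b]].

Definition J_rate (Ls : 'I_K -> R -> \bar R) (Hwc : 'cV[R]_K -> 'cV[R]_K)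
    mu b : \bar R :=
  ereal_inf [set Isharp_inf Ls a | a in
    [set a | DK_space mu a /\
       cluster_set (DK_space mu) DK_cvg (G_inf Hwc) a b]].

End queues.

(* Main.v *)
Require Import Defs.
From HB Require Import structures.
From mathcomp Require Import all_boot all_order all_algebra.
From mathcomp Require Import all_classical all_reals all_analysis.
From mathcomp Require Import measurable_realfun.
From mathcomp Require Import ring lra zify.

Set Implicit Arguments.
Unset Strict Implicit.
Unset Printing Implicit Defensive.

Import Order.TTheory GRing.Theory Num.Theory.
Import numFieldNormedType.Exports.

Local Open Scope classical_set_scope.
Local Open Scope ring_scope.

(** * Finite and infinite horizon rate functions of max-weight scheduling

   Write [c] for the smallest capacity, attained at the queue [k1].  A workload
   in the simplex is served completely in one slot ([leftover_simplex]), after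
   which the past is forgotten: the workload regenerates.

   A path over a finite horizon is extended to the infinite past by arrivals at
   the mean rate.  They cost nothing, by Jensen's inequality
   ([fenchel_legendre_mean]), and since the mean lies in the simplex they are
   served at once, so that they do not change the workload ([G_inf_extend]).
   This bounds the infinite horizon rate by each finite horizon rate
   ([J_rate_le]).

   Conversely a path is truncated at a regeneration time.  The maximal weight
   rule may waste capacity, because it may select a queue that holds less than
   its capacity; still, outside the simplex each slot diminishes the linear form
   with coefficients [C] by at least [c ^+ 2] ([leftover_drop]).  If this form
   is less than [c ^+ 2] at the mean, then the regeneration times are bounded
   along each sequence that converges in the scaled uniform topology
   ([regeneration_bounded]), and the other inequality follows ([I_rate_le_J]).

   Because of the waste, a mean in the interior of the simplex need not satisfy
   this condition.  It is a consequence of the existence of the infinite horizon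
   workload ([mean_weight_lt]).  If it failed, there would be arrivals with the
   given averages under which the workload never regenerates: queue [k1] is kept
   slightly above [c], and the queues with larger capacities divert just enough
   slots from it, by packages which are smaller than these capacities.  As queue
   [k1] never wastes capacity, small deviations in it persist forever.  They can
   be given both signs, depending on the time when the workload started
   ([run_below], [run_above]); a tie in the last slot turns the signs into
   distances of at least [c / 2], so that the workloads do not converge
   ([itin_not_cvg]). *)

(** * Rate functions *)

Section cumulants.
Context {R : realType}.
Local Open Scope ereal_scope.

Lemma expR_mean_le {d} {T : measurableType d} (P : probability T R)
    (X : {RV P >-> R}) (m c : R) :
  (forall w, 0 <= X w)%R -> 'E_P[X] = m%:E ->
  (expR (c * m))%:E <= 'E_P[fun w => expR (c * X w)].
Proof.
move=> X0 EX.
have mX : measurable_fun [set: T] X by [].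
have mE : measurable_fun [set: T] (fun w => expR (c * X w)).
  apply: measurableT_comp => //.
  apply: measurable_funM => //.
have [->|Efin] := eqVneq 'E_P[fun w => expR (c * X w)] +oo.
  by rewrite leey.
have iX : P.-integrable [set: T] (EFin \o X).
  apply/integrableP; split; first exact/measurable_EFinP.
  under eq_integral => w _ do rewrite /= ger0_norm//.
  by move: EX; rewrite unlock => ->; rewrite ltry.
have iE : P.-integrable [set: T] (EFin \o (fun w => expR (c * X w))).
  apply/integrableP; split; first exact/measurable_EFinP.
  under eq_integral => w _ do rewrite /= ger0_norm ?expR_ge0//.
  by move: Efin; rewrite unlock ltey.
have iC (r : R) : P.-integrable [set: T] (EFin \o cst r).
  by apply/Lfun1_integrable; exact: Lfun_cst.
(* the tangent of the exponential at the mean lies below it *)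
pose g w := (expR (c * m) * (1 - c * m) + (expR (c * m) * c) * X w)%R.
have ig2 : P.-integrable [set: T]
    (fun w => (expR (c * m) * c)%:E * (X w)%:E) by exact: integrableZl.
have ig : P.-integrable [set: T] (EFin \o g).
  have -> : EFin \o g = (EFin \o cst (expR (c * m) * (1 - c * m))%R)
    \+ (fun w => (expR (c * m) * c)%:E * (X w)%:E).
    by apply/funext => w /=; rewrite /g EFinD EFinM.
  by apply: integrableD.
have Eg : \int[P]_w (g w)%:E = (expR (c * m))%:E.
  rewrite (_ : (fun w => (g w)%:E) =
      (fun w => (EFin \o cst (expR (c * m) * (1 - c * m))%R) w
               + (expR (c * m) * c)%:E * (X w)%:E)); last first.
    by apply/funext => w /=; rewrite /g EFinD EFinM.
  rewrite integralD//= integral_cst//= probability_setT mule1.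
  rewrite integralZl//.
  move: EX; rewrite unlock => ->.
  by rewrite -EFinM -EFinD; congr EFin; ring.
rewrite -Eg unlock; apply: le_integral => // w _ /=.
rewrite lee_fin /g.
have -> : (c * X w = c * m + (c * X w - c * m))%R by ring.
rewrite expRD.
have := expR_ge1Dx (c * X w - c * m)%R.
move=> /(ler_wpM2l (expR_ge0 (c * m))).
by apply: le_trans; lra.
Qed.

(** Jensen's inequality for the exponential. *)
Lemma scaled_cgf_ge {d} {T : measurableType d} (P : probability T R)
    (L : nat) (X : {RV P >-> R}) (m theta : R) :
  (forall w, 0 <= X w)%R -> 'E_P[X] = m%:E ->
  (theta * m)%:E <= scaled_cgf L X theta.
Proof.
move=> X0 EX; rewrite /scaled_cgf.
have := expR_mean_le (theta * L.+1%:R)%R X0 EX.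
set E := ('E_P[_]) => hE.
have hl : (theta * L.+1%:R * m)%:E <= lne E.
  rewrite -[X in X <= _](expeRK (theta * L.+1%:R * m)%:E).
  rewrite lee_lne// in_itv/= leey andbT ?lee_fin ?expR_ge0//.
  by rewrite (le_trans _ hE)// lee_fin expR_ge0.
have -> : (theta * m)%:E = (L.+1%:R^-1)%:E * (theta * L.+1%:R * m)%:E.
  rewrite -EFinM; congr EFin.
  have : (L.+1%:R != 0 :> R)%R by rewrite pnatr_eq0.
  by move=> ?; field.
by apply: lee_wpmul2l => //; rewrite lee_fin invr_ge0.
Qed.

Lemma scaled_cgf0 {d} {T : measurableType d} (P : probability T R)
    (L : nat) (X : {RV P >-> R}) : scaled_cgf L X 0%R = 0.
Proof.
rewrite /scaled_cgf.
rewrite (_ : (fun w => _) = cst 1%R); last first.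
  by apply/funext => w /=; rewrite !mul0r expR0.
by rewrite expectation_cst lne1 mule0.
Qed.

Context {d : nat -> measure_display} {T : forall L, measurableType (d L)}.
Context {P : forall L, probability (T L) R}.
Context {X : forall L, {RV P L >-> R}} {Lambda : R -> \bar R}.
Hypothesis GE : gartner_ellis X Lambda.

Lemma fenchel_legendre_ge0 (x : R) : 0 <= fenchel_legendre Lambda x.
Proof.
have [/(_ 0%R)[_ L0] _ _ _] := GE.
have {}L0 : Lambda 0%R = 0.
  apply: (cvg_unique _ L0) => //.
  rewrite (_ : (fun L => _) = cst 0); first exact: cvg_cst.
  by apply/funext => L; rewrite scaled_cgf0.
apply: ereal_sup_ubound; exists 0%R => //.
by rewrite L0 mul0r sube0.
Qed.

(** The mean is the slope of a supporting line of [Lambda] at the origin. *)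
Lemma fenchel_legendre_mean (m : R) :
  (forall L w, 0 <= X L w)%R -> (forall L, 'E_(P L)[X L] = m%:E) ->
  fenchel_legendre Lambda m = 0.
Proof.
move=> X0 EX; apply/eqP; rewrite eq_le fenchel_legendre_ge0 andbT.
apply: ge_ereal_sup => _ [theta _ <-].
have [/(_ theta)[_ Lth] _ _ _] := GE.
have : (theta * m)%:E <= Lambda theta.
  have <- := cvg_lim (@ereal_hausdorff _) Lth.
  apply: lime_ge; first by apply/cvg_ex; exists (Lambda theta).
  by apply: nearW => L; exact: scaled_cgf_ge.
by rewrite sube_le0.
Qed.

End cumulants.

(** * One slot of the scheduler *)

Section dynamics.
Context {R : realType} {K : nat}.
Implicit Types (w h b : 'cV[R]_K) (C : 'I_K -> R) (a : 'I_K -> nat -> R).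

Definition arrivals a (n : nat) : 'cV[R]_K := \col_k a k n.

Definition leftover (Hwc : 'cV[R]_K -> 'cV[R]_K) w := pos_part (w - Hwc w).

(** The recursion on the horizon, with an arbitrary initial workload: the
   slots are consumed from the oldest one on, so that the structural recursion
   follows the evolution in time and the last step uses index 0. *)
Fixpoint run (Hwc : 'cV[R]_K -> 'cV[R]_K) a (t : nat) w :=
  if t is s.+1 then run Hwc a s (leftover Hwc w + arrivals a s) else w.

Lemma G_fin_recent Hwc a t : G_fin Hwc (recent t a) = run Hwc a t 0.
Proof.
rewrite /G_fin.
have -> : (fun (i : 'I_t) w => pos_part (w - Hwc w) + col i (recent t a)) =
          (fun (i : 'I_t) w => leftover Hwc w + arrivals a (val i)).
  apply/funext => i; apply/funext => w; congr (_ + _).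
  by apply/colP => k; rewrite !mxE.
have -> (s : seq 'I_t) : foldr (fun i w => leftover Hwc w + arrivals a (val i)) 0 s =
    foldr (fun i w => leftover Hwc w + arrivals a i) 0 (map val s).
  by elim: s => //= i s ->.
rewrite val_enum_ord.
elim: t 0 => [//|t IH] w.
by rewrite -[in iota _ _](addn1 t) iotaD foldr_cat /= add0n -IH.
Qed.

Lemma run_add Hwc a s t w : run Hwc a (s + t) w =
  run Hwc a s (run Hwc (fun k n => a k (s + n)%N) t w).
Proof.
elim: t w => [|t IH] w; first by rewrite addn0.
by rewrite addnS/= IH.
Qed.

Lemma eq_run Hwc a a' t w : (forall k n, (n < t)%N -> a k n = a' k n) ->
  run Hwc a t w = run Hwc a' t w.
Proof.
elim: t w => //= t IH w e.
rewrite IH => [|k n nt]; last by rewrite e// ltnW.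
by congr run; congr (_ + _); apply/colP => k; rewrite !mxE e.
Qed.

Lemma leftover_ge0 Hwc w k : 0 <= leftover Hwc w k ord0.
Proof. by rewrite mxE le_max lexx. Qed.

Lemma nonneg0 t : nonneg (0 : 'M[R]_(K, t)).
Proof. by move=> k i; rewrite mxE. Qed.

End dynamics.

Section max_weight.
Context {R : realType} {K : nat}.
Variables (C : 'I_K -> R) (H Hwc : 'cV[R]_K -> 'cV[R]_K).
Hypothesis C0 : forall k, 0 < C k.
Hypothesis mwH : max_weight C H.
Hypothesis wcH : work_conserving C H Hwc.
Implicit Types (w h b : 'cV[R]_K).

Definition vertex (j : 'I_K) : 'cV[R]_K := \col_k (if k == j then C j else 0).

Lemma sum_vertex (j : 'I_K) (f : 'I_K -> R) :
  \sum_k vertex j k ord0 * f k = C j * f j.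
Proof.
rewrite (bigD1 j)//= mxE eqxx big1 ?addr0// => k kj.
by rewrite mxE (negbTE kj) mul0r.
Qed.

Lemma simplex_vertex j : simplex C (vertex j).
Proof.
split=> [k i|]; first by rewrite mxE; case: ifP => // _; exact: ltW.
by rewrite sum_vertex divff// gt_eqF.
Qed.

Lemma simplex_le w k : simplex C w -> w k ord0 <= C k.
Proof.
move=> [w0 ws]; rewrite -[leRHS]mul1r -ler_pdivrMr//.
apply: le_trans ws; rewrite (bigD1 k)//= lerDl sumr_ge0// => i _.
by rewrite divr_ge0// ltW.
Qed.

(** The value of the linear form at [h] falls short of its maximum over the
   simplex by a sum of nonnegative defects, one for the unused capacity and one
   for each queue; at a maximizer all of them vanish. *)
Lemma argmax_vertices w h j : is_argmax (simplex C) w h ->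
  (forall i, C i * w i ord0 <= C j * w j ord0) -> 0 < w j ord0 ->
  \sum_i h i ord0 / C i = 1 /\
  forall i, C i * w i ord0 < C j * w j ord0 -> h i ord0 = 0.
Proof.
move=> [[h0 hs] hmax] jmax wj.
have := hmax _ (simplex_vertex j); rewrite /inner sum_vertex.
set m := C j * w j ord0; have m0 : 0 < m by rewrite mulr_gt0.
have -> : \sum_k h k ord0 * w k ord0 =
    m * (\sum_i h i ord0 / C i) - \sum_i h i ord0 / C i * (m - C i * w i ord0).
  rewrite mulr_sumr -sumrB; apply: eq_bigr => i _.
  by have := C0 i => ?; field; rewrite gt_eqF.
set D := \sum_i h i ord0 / C i * _.
have D0 : forall i, true -> 0 <= h i ord0 / C i * (m - C i * w i ord0).
  by move=> i _; rewrite mulr_ge0 ?subr_ge0 ?divr_ge0// ltW.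
have Dge0 : 0 <= D by exact: sumr_ge0.
move=> mle.
have s1 : \sum_i h i ord0 / C i = 1.
  apply/eqP; rewrite eq_le hs/= leNgt; apply/negP => s1.
  by have : m * (\sum_i h i ord0 / C i) < m; [rewrite gtr_pMr|lra].
split=> // i Ci.
have D00 : D = 0 by rewrite s1 mulr1 in mle; lra.
move/eqP: D00; rewrite psumr_eq0// => /allP /(_ i (mem_index_enum _)) /=.
rewrite mulf_eq0 subr_eq0 (gt_eqF Ci) orbF mulf_eq0 invr_eq0 (gt_eqF (C0 i)) orbF.
by move/eqP.
Qed.

Lemma Hwc_outside w k : nonneg w -> C k <= w k ord0 -> is_argmax (simplex C) w (Hwc w).
Proof.
move=> w0 Ck; have [_ /(_ w w0)[_ ->]] := wcH; first exact: mwH.2.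
by move=> /(_ k); rewrite ltNge Ck.
Qed.

Lemma Hwc_inside w : nonneg w -> (forall k, w k ord0 < C k) ->
  is_proj (simplex C) w (Hwc w).
Proof. by move=> w0 wC; have [_ /(_ w w0)[+ _]] := wcH; exact. Qed.

(** The truncation at 0 is where the maximal weight rule wastes capacity: the
   queue it selects may hold less than its own capacity. *)
Lemma leftover_argmax w j k : nonneg w -> C k <= w k ord0 ->
  (forall i, i != j -> C i * w i ord0 < C j * w j ord0) ->
  leftover Hwc w =
    \col_i (if i == j then Num.max 0 (w j ord0 - C j) else w i ord0).
Proof.
move=> w0 Ck jmax.
have wj : 0 < w j ord0.
  have [kj|kj] := eqVneq k j; first by rewrite -kj (lt_le_trans _ Ck).
  rewrite -(pmulr_rgt0 _ (C0 j)); apply: le_lt_trans (jmax _ kj).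
  by rewrite mulr_ge0// ltW.
have [|//|s1 hz] := argmax_vertices (Hwc_outside w0 Ck) (j := j).
  by move=> i; have [->//|/jmax/ltW] := eqVneq i j.
have hj : Hwc w j ord0 = C j.
  move: s1; rewrite (bigD1 j)//= big1 ?addr0.
    by move=> /(congr1 (fun x => x * C j)); rewrite mul1r divfK// gt_eqF.
  by move=> i ij; rewrite hz ?mul0r//; exact: jmax.
apply/colP => i; rewrite !mxE; case: eqVneq => [->|ij]; first by rewrite hj.
by rewrite hz ?subr0; [apply/max_idPr|exact: jmax].
Qed.

Lemma eucl_norm_lt w h k : (forall k, w k ord0 ^+ 2 <= h k ord0 ^+ 2) ->
  w k ord0 ^+ 2 < h k ord0 ^+ 2 -> eucl_norm w < eucl_norm h.
Proof.
move=> wh whk; rewrite ltr_sqrt; last first.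
  rewrite (bigD1 k)//= ltr_pwDl ?sumr_ge0//; last by move=> i _; rewrite sqr_ge0.
  by rewrite (le_lt_trans _ whk)// sqr_ge0.
rewrite (bigD1 k)//= [ltRHS](bigD1 k)//= ltr_leD// ler_sum//.
Qed.

(** Truncating the allocation at the workload would bring it closer. *)
Lemma proj_le w h k : nonneg w -> is_proj (simplex C) w h -> h k ord0 <= w k ord0.
Proof.
move=> w0 [[h0 hs] hmin]; rewrite leNgt; apply/negP => wh.
pose s : 'cV[R]_K := \col_i Num.min (h i ord0) (w i ord0).
have ss : simplex C s.
  split=> [i j|]; first by rewrite ord1 mxE le_min h0 w0.
  apply: le_trans hs; apply: ler_sum => i _.
  by rewrite ler_pM2r ?invr_gt0// mxE ge_min lexx.
have := hmin _ ss; rewrite leNgt => /negP; apply.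
apply: (@eucl_norm_lt _ _ k) => [i|]; rewrite !mxE.
  by rewrite minEle; case: ifP => // /negbT; rewrite -ltNge => hw; rewrite subrr expr0n/= sqr_ge0.
by rewrite minEle leNgt wh/= subrr expr0n/= exprn_even_gt0//= subr_eq0 lt_eqF.
Qed.

Lemma proj_simplex w h : is_proj (simplex C) w h -> simplex C w -> h = w.
Proof.
move=> [_ hmin] ws; have := hmin _ ws.
have -> : eucl_norm (w - w) = 0.
  rewrite /eucl_norm big1 ?sqrtr0// => k _.
  by rewrite subrr mxE expr0n.
rewrite /eucl_norm => n0; have : \sum_k (w - h) k ord0 ^+ 2 == 0.
  have sge : 0 <= \sum_k (w - h) k ord0 ^+ 2 by apply: sumr_ge0 => *; exact: sqr_ge0.
  rewrite eq_le sge andbT leNgt -sqrtr_gt0 -leNgt//.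
rewrite psumr_eq0; last by move=> *; rewrite sqr_ge0.
move=> /allP h1; apply/colP => k.
have := h1 k (mem_index_enum _); rewrite /= sqrf_eq0 !mxE subr_eq0.
by move/eqP => ->.
Qed.

(** If capacity were left, serving a little more of an underserved queue would
   stay in the simplex and be closer to the workload. *)
Lemma proj_full w h : nonneg w -> is_proj (simplex C) w h -> ~ simplex C w ->
  \sum_k h k ord0 / C k = 1.
Proof.
move=> w0 ph ws; have hw k : h k ord0 <= w k ord0 by exact: proj_le ph.
have [[h0 hs] hmin] := ph.
apply/eqP; rewrite eq_le hs/= leNgt; apply/negP => s1.
have [k wk] : exists k, h k ord0 < w k ord0.
  apply/existsP; apply: contra_notT ws => /existsPn hw'.
  suff <- : h = w by [].
  by apply/colP => k; apply/eqP; rewrite eq_le hw/= leNgt hw'.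
pose e := Num.min (w k ord0 - h k ord0) (C k * (1 - \sum_k h k ord0 / C k)).
have e0 : 0 < e by rewrite lt_min subr_gt0 wk mulr_gt0// subr_gt0.
pose s : 'cV[R]_K := h + \col_i (if i == k then e else 0).
have ss : simplex C s.
  split=> [i j|]; first by rewrite ord1 !mxE addr_ge0//; case: ifP => // _; exact: ltW.
  under eq_bigr do rewrite !mxE mulrDl; rewrite big_split/=.
  rewrite [X in _ + X](bigD1 k)//= eqxx [X in _ + (_ + X)]big1 ?addr0; last first.
    by move=> i /negbTE ->; rewrite mul0r.
  rewrite -lerBrDl ler_pdivrMr// mulrC.
  by rewrite ge_min lexx orbT.
have ek : e <= w k ord0 - h k ord0 by rewrite ge_min lexx.
have := hmin _ ss; rewrite leNgt => /negP; apply.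
apply: (@eucl_norm_lt _ _ k) => [i|]; rewrite !mxE.
  case: eqVneq => [->|_]; last by rewrite addr0.
  by rewrite ler_sqr ?nnegrE; lra.
by rewrite eqxx ltr_sqr ?nnegrE; lra.
Qed.

(** In the box the projection of such a workload is itself.  The only workloads
   of the simplex outside the box are its vertices, each of which is the unique
   maximizer of the linear form that it defines. *)
Lemma leftover_simplex w : simplex C w -> leftover Hwc w = 0.
Proof.
move=> ws; have [w0 wsum] := ws.
have [wC|/existsNP[k /negP]] := pselect (forall k, w k ord0 < C k).
  rewrite /leftover (proj_simplex (Hwc_inside w0 wC) ws) subrr.
  by apply/colP => k; rewrite !mxE maxxx.
rewrite -leNgt => Ck; have [[h0 _] hmax] := Hwc_outside w0 Ck.
have wk : w k ord0 = C k by apply/eqP; rewrite eq_le Ck simplex_le.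
have wz i : i != k -> w i ord0 = 0.
  move=> ik; move: wsum; rewrite (bigD1 k)//= wk divff ?gt_eqF//.
  rewrite (bigD1 i)//= => hle.
  have : w i ord0 / C i <= 0.
    have : 0 <= \sum_(i0 < K | (i0 != k) && (i0 != i)) w i0 ord0 / C i0.
      by apply: sumr_ge0 => *; rewrite divr_ge0// ltW.
    lra.
  rewrite ler_pdivrMr// mul0r => wi.
  by apply/eqP; rewrite eq_le wi w0.
have hk : C k <= Hwc w k ord0.
  have := hmax _ (simplex_vertex k); rewrite /inner sum_vertex wk.
  rewrite (bigD1 k)//= big1 ?addr0; last by move=> i /wz ->; rewrite mulr0.
  by rewrite wk ler_pM2r.
apply/colP => i; rewrite !mxE; apply/max_idPl; rewrite subr_le0.
by have [->|/wz ->] := eqVneq i k; rewrite ?wk.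
Qed.

(** A queue selected by the maximal weight rule beats a queue that holds at
   least its own capacity; even if less than its capacity can be served of it, this part
   therefore weighs at least [c ^+ 2].  In the box nothing is wasted, and each
   unit of capacity has at least this weight. *)
Lemma leftover_drop (c : R) w : 0 < c -> (forall k, c <= C k) ->
  nonneg w -> ~ simplex C w ->
  \sum_k leftover Hwc w k ord0 * C k <= \sum_k w k ord0 * C k - c ^+ 2.
Proof.
move=> c0 cC w0 ws.
have cC2 k : c ^+ 2 <= C k ^+ 2 by rewrite ler_sqr ?nnegrE ?(ltW (C0 _))// ltW.
suff [p [p0 p1 lp]] : exists p : 'I_K -> R, [/\ forall k, 0 <= p k,
    \sum_k p k = 1 & forall k, leftover Hwc w k ord0 * C k <=
      w k ord0 * C k - p k * c ^+ 2].
  rewrite -[X in _ - X]mul1r -p1 mulr_suml -sumrB.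
  by apply: ler_sum => k _; exact: lp.
exists (fun k => Hwc w k ord0 / C k).
have [wC|/existsNP[k /negP]] := pselect (forall k, w k ord0 < C k).
  have pw := Hwc_inside w0 wC; have [[h0 _] _] := pw.
  split=> [k||k]; first by rewrite divr_ge0// ltW.
    exact: proj_full pw ws.
  have hle := proj_le k w0 pw.
  rewrite !mxE (max_idPr _) ?subr_ge0// mulrBl lerD2l lerN2.
  rewrite mulrAC ler_pdivrMr// -mulrA ler_wpM2l// -expr2; exact: cC2.
rewrite -leNgt => Ck; have am := Hwc_outside w0 Ck; have [[h0 _] _] := am.
pose j := [arg max_(i > k) C i * w i ord0]%O.
have jmax i : C i * w i ord0 <= C j * w j ord0.
  by rewrite /j; case: arg_maxP => //= m _ ->.
have Cj : c ^+ 2 <= C j * w j ord0.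
  apply: le_trans (jmax k); apply: le_trans (cC2 k) _.
  by rewrite expr2 ler_pM2l.
have wj : 0 < w j ord0.
  by rewrite -(pmulr_rgt0 _ (C0 j)) (lt_le_trans _ Cj)// exprn_gt0.
have [s1 hz] := argmax_vertices am jmax wj.
split=> // i; first by rewrite divr_ge0// ltW.
have := jmax i; rewrite le_eqVlt => /orP[/eqP wij|/hz hi0]; last first.
  by rewrite !mxE hi0 subr0 !mul0r subr0 (max_idPr _)//.
rewrite !mxE maxEle; case: ifP => _.
  rewrite mulrBl lerD2l lerN2 mulrAC ler_pdivrMr// -mulrA ler_wpM2l//.
  by rewrite -expr2; exact: cC2.
rewrite mul0r subr_ge0 [leRHS]mulrC wij.
apply: le_trans Cj; rewrite ler_piMl ?sqr_ge0//.
by rewrite ler_pdivrMr// mul1r simplex_le//; case: am.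
Qed.

End max_weight.

(** * Sequences of arrivals *)

Section sequences.
Context {R : realType}.

Lemma average_mean (x : nat -> R) : average x = arithmetic_mean x.
Proof.
apply/funext => n; rewrite /average /arithmetic_mean /= seriesEord/=.
by rewrite mulrC.
Qed.

Lemma D_space_average (x : nat -> R) m : (forall i, 0 <= x i) ->
  average x @ \oo --> m -> D_space m x.
Proof.
move=> x0 xm; split=> //.
have /cvg_seq_bounded : cvgn (average x) by apply/cvg_ex; exists m.
move=> [B [_ /(_ (B + 1))]]; rewrite ltrDl => /(_ ltr01) hB.
apply: (@le_lt_trans _ _ (B + 1)%:E); last exact: ltry.
by apply: ge_ereal_sup => _ [t _ <-]; rewrite lee_fin; exact: hB.
Qed.

Lemma cvg_mx (m n : nat) (u : nat -> 'M[R]_(m, n)) (l : 'M[R]_(m, n)) :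
  (forall i j, (fun k => u k i j) @ \oo --> l i j) -> u @ \oo --> l.
Proof.
move=> h; apply/cvg_mx_entourageP => A eA.
have hij i j : \forall k \near \oo, (l i j, u k i j) \in A.
  have /cvg_entourageP /(_ _ eA) hA := h i j.
  have {}hA : \forall k \near \oo, A (l i j, u k i j) by [].
  by move: hA => [N _ hN]; exists N => // k /hN hk /=; rewrite inE.
have := @filter_forall nat ('I_m * 'I_n)%type (fun ij k => (l ij.1 ij.2, u k ij.1 ij.2) \in A) \oo _ (fun ij => hij ij.1 ij.2).
move=> hu; suff : \forall k \near \oo, forall i j, (l i j, u k i j) \in A by [].
by move: hu => [N _ hN]; exists N => // k /hN hk i j; exact: (hk (i, j)).
Qed.

Lemma norm_average_le (x : nat -> R) n : (`|average x n|%:E <= scaled_norm x)%E.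
Proof. by apply: ereal_sup_ubound; exists n. Qed.

End sequences.

(** * Extending a finite horizon to the infinite past *)

Section extension.
Context {R : realType} {K : nat}.
Variables (C : 'I_K -> R) (H Hwc : 'cV[R]_K -> 'cV[R]_K) (mu : 'cV[R]_K).
Hypothesis C0 : forall k, 0 < C k.
Hypothesis mwH : max_weight C H.
Hypothesis wcH : work_conserving C H Hwc.

Lemma run_simplex a t w : simplex C w -> run Hwc a t.+1 w = run Hwc a t.+1 0.
Proof.
move=> ws; rewrite /= (leftover_simplex C0 mwH wcH ws).
rewrite (leftover_simplex C0 mwH wcH (w := 0))//.
split; first exact: nonneg0.
by rewrite big1 ?ler01// => k _; rewrite mxE mul0r.
Qed.

Hypothesis mu_int : order_int (simplex C) mu.
Let mu_simplex : simplex C mu. Proof. by case: mu_int. Qed.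

Lemma simplex0 : simplex C 0.
Proof.
split; first exact: nonneg0.
by rewrite big1 ?ler01// => k _; rewrite mxE mul0r.
Qed.

Lemma run_mean t w : simplex C w ->
  simplex C (run Hwc (fun k _ => mu k ord0) t w).
Proof.
elim: t w => //= t IH w ws; apply: IH.
rewrite (leftover_simplex C0 mwH wcH ws) add0r.
by rewrite (_ : arrivals _ _ = mu)//; apply/colP => k; rewrite mxE.
Qed.

Definition extend (t : nat) (x : 'M[R]_(K, t)) (k : 'I_K) (n : nat) : R :=
  if insub n is Some i then x k i else mu k ord0.

Lemma recent_extend t (x : 'M[R]_(K, t)) : recent t (extend x) = x.
Proof. by apply/matrixP => k i; rewrite mxE /extend valK. Qed.

Lemma extend_mean t (x : 'M[R]_(K, t)) k n : (t <= n)%N -> extend x k n = mu k ord0.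
Proof. by move=> tn; rewrite /extend insubF// ltnNge tn. Qed.

(** Arrivals at the mean rate are served at once, so that the past they fill
   has no influence on the present. *)
Lemma G_inf_extend t (x : 'M[R]_(K, t)) : (1 <= t)%N ->
  G_inf Hwc (extend x) = G_fin Hwc x.
Proof.
case: t x => // t x _; rewrite /G_inf -[in RHS](recent_extend x) G_fin_recent.
apply: norm_lim_near_cst.
exists t.+1 => // s /= ts; rewrite G_fin_recent -(subnKC ts) run_add.
apply: run_simplex.
rewrite (@eq_run _ _ _ _ (fun k _ => mu k ord0)).
  exact: run_mean simplex0.
by move=> k n _; rewrite extend_mean// leq_addr.
Qed.

Lemma extend_ge0 t (x : 'M[R]_(K, t)) k n : nonneg x -> 0 <= extend x k n.
Proof.
move=> x0; rewrite /extend; case: insubP => [i _ _|_]; first exact: x0.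
by have [+ _] := mu_simplex; exact.
Qed.

Lemma extend_DK t (x : 'M[R]_(K, t)) : nonneg x -> DK_space mu (extend x).
Proof.
move=> x0 k; apply: D_space_average => [i|]; first exact: extend_ge0.
rewrite average_mean; apply: cesaro.
apply: cvg_near_cst.
by exists t => // n /= tn; exact: extend_mean.
Qed.

Lemma scaled_norm_extend t (x y : 'M[R]_(K, t)) k :
  (scaled_norm (extend x k \- extend y k)%R <= (\sum_(i < t) `|x k i - y k i|)%:E)%E.
Proof.
apply: ge_ereal_sup => _ [n _ <-]; rewrite lee_fin /average.
rewrite normrM [X in _ * X]ger0_norm ?invr_ge0//.
rewrite ler_pdivrMr//.
have s0 : 0 <= \sum_(i < t) `|x k i - y k i| by exact: sumr_ge0.
have n1 : 1 <= n.+1%:R :> R by rewrite ler1n.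
suff : `|\sum_(i < n.+1) (extend x k i - extend y k i)| <=
    \sum_(i < t) `|x k i - y k i| by move=> /le_trans; apply; rewrite ler_peMr.
apply: le_trans (ler_norm_sum _ _ _) _.
rewrite -(big_mkord xpredT (fun i => `|extend x k i - extend y k i|)).
have -> : \sum_(i < t) `|x k i - y k i| =
    \sum_(0 <= i < t) `|extend x k i - extend y k i|.
  by rewrite big_mkord; apply: eq_bigr => i _; rewrite /extend valK.
have [nt|tn] := leqP n.+1 t.
  rewrite [leRHS](big_cat_nat (n := n.+1))//= lerDl sumr_ge0//.
rewrite (big_cat_nat (n := t)) ?(ltnW tn)//=.
rewrite [X in _ + X]big_nat_cond [X in _ + X]big1 ?addr0// => i /andP[/andP[ti _] _].
by rewrite !extend_mean// subrr normr0.
Qed.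

Lemma DK_cvg_extend t (u : nat -> 'M[R]_(K, t)) (x : 'M[R]_(K, t)) :
  u @ \oo --> x -> DK_cvg (fun n => extend (u n)) (extend x).
Proof.
move=> ux k.
apply: (@squeeze_cvge _ _ _ _ (cst 0%E) _
  (fun n => (\sum_(i < t) `|u n k i - x k i|)%:E)).
- apply: nearW => n; rewrite scaled_norm_extend andbT.
  by apply: le_trans (norm_average_le _ 0%N); rewrite lee_fin.
- exact: cvg_cst.
- apply: cvg_EFin; first exact: nearW.
  rewrite [X in _ --> X](_ : 0 = \sum_(i < t) 0 :> R); last by rewrite big1.
  apply: (@cvg_big _ _ _ _ _ _ _ _ _ (fun i n => `|u n k i - x k i|) (fun=> 0)) => [|i _].
    exact: add_continuous.
  have uki : (fun n => u n k i) @ \oo --> x k i.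
        exact: (@cvg_comp _ _ _ u (fun M : 'M[R]_(K, t) => M k i) \oo (nbhs x) (nbhs (x k i)) ux (@coord_continuous R K t k i x)).
  have := cvg_norm (cvgB uki (cvg_cst (x k i))).
  by rewrite subrr normr0; apply.
Qed.

Variable Ls : 'I_K -> R -> \bar R.
Hypothesis Ls_ge0 : forall k x, (0 <= Ls k x)%E.
Hypothesis Ls_mean : forall k, Ls k (mu k ord0) = 0%E.

Lemma Isharp_inf_extend t (x : 'M[R]_(K, t)) :
  Isharp_inf Ls (extend x) = Isharp_fin Ls x.
Proof.
apply: eq_bigr => k _.
rewrite (nneseries_split _ t)// eseries0 ?adde0.
  by rewrite add0n big_mkord; apply: eq_bigr => i _; rewrite /extend valK.
by move=> i; rewrite add0n => ti _; rewrite extend_mean.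
Qed.

Lemma J_rate_le t b : (1 <= t)%N -> (J_rate Ls Hwc mu b <= I_rate Ls Hwc t b)%E.
Proof.
move=> t1; apply/le_ereal_inf_tmp => _ [x [x0 [u [u0 ux ub]]] <-].
apply: ge_ereal_inf.
exists (Isharp_inf Ls (extend x)); last by rewrite Isharp_inf_extend.
exists (extend x) => //; split; first exact: extend_DK.
exists (fun n => extend (u n)); split => [n||].
- exact: extend_DK.
- exact: DK_cvg_extend.
- rewrite (_ : _ \o _ = G_fin Hwc \o u)//.
  by apply/funext => n /=; rewrite G_inf_extend.
Qed.

End extension.

(** * Uniform regeneration *)

Section regeneration.
Context {R : realType} {K : nat}.
Variables (C : 'I_K -> R) (H Hwc : 'cV[R]_K -> 'cV[R]_K) (mu : 'cV[R]_K).
Hypothesis C0 : forall k, 0 < C k.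
Hypothesis mwH : max_weight C H.
Hypothesis wcH : work_conserving C H Hwc.
Variable c : R.
Hypothesis c0 : 0 < c.
Hypothesis cC : forall k, c <= C k.

(** Up to the factor [c ^+ 2], the Lyapunov function of the scheduler. *)
Definition weight (w : 'cV[R]_K) := \sum_k w k ord0 * C k.

Lemma weightD v w : weight (v + w) = weight v + weight w.
Proof. by rewrite /weight -big_split; apply: eq_bigr => k _; rewrite mxE mulrDl. Qed.

Lemma weight_ge0 w : nonneg w -> 0 <= weight w.
Proof. by move=> w0; apply: sumr_ge0 => k _; rewrite mulr_ge0// ltW. Qed.

Definition total_weight (a : 'I_K -> nat -> R) t :=
  \sum_(i < t) weight (arrivals a i).

(** The weight of the arrivals has to pay for all slots since the last
   regeneration. *)
Lemma run_regenerates a t w : (forall k n, 0 <= a k n) -> nonneg w ->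
  (exists s, [/\ (1 <= s <= t)%N, run Hwc a t w = run Hwc a s 0 &
                 c ^+ 2 * s.-1%:R <= total_weight a s]) \/
  c ^+ 2 * t%:R <= weight w + total_weight a t.
Proof.
move=> a0; elim: t w => [|t IH] w w0.
  by right; rewrite mulr0 /total_weight big_ord0 addr0 weight_ge0.
have aw n : nonneg (arrivals a n) by move=> k i; rewrite ord1 mxE.
have [ws|ws] := pselect (simplex C w); last first.
  have w'0 : nonneg (leftover Hwc w + arrivals a t).
    by move=> k i; rewrite ord1 mxE addr_ge0 ?leftover_ge0//; exact: aw.
  have [[s [/andP[s1 st] e hs]]|h] := IH _ w'0.
    by left; exists s; split=> //; rewrite s1 ltnW.
  right; move: h; rewrite weightD /total_weight big_ord_recr/=.
  have := leftover_drop C0 mwH wcH c0 cC w0 ws.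
  rewrite -/(weight _) -/(weight _) -natr1; lra.
left; rewrite (run_simplex C0 mwH wcH _ _ ws).
have := IH _ (aw t).
rewrite /= (leftover_simplex C0 mwH wcH (simplex0 C)) add0r.
move=> [[s [/andP[s1 st] e hs]]|h].
  by exists s; split=> //; rewrite s1 ltnW.
exists t.+1; split => //=.
  by rewrite (leftover_simplex C0 mwH wcH (simplex0 C)) add0r.
by rewrite /total_weight big_ord_recr/= addrC.
Qed.

Lemma run0_regenerates a t : (forall k n, 0 <= a k n) -> (1 <= t)%N ->
  exists s, [/\ (1 <= s <= t)%N, run Hwc a t 0 = run Hwc a s 0 &
                 c ^+ 2 * s.-1%:R <= total_weight a s].
Proof.
case: t => // t a0 _.
have aw n : nonneg (arrivals a n) by move=> k i; rewrite ord1 mxE.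
have := run_regenerates t a0 (aw t).
move=> [[s [/andP[s1 st] e hs]]|h].
  exists s; split=> //; first by rewrite s1 ltnW.
  by rewrite -e /= (leftover_simplex C0 mwH wcH (simplex0 C)) add0r.
exists t.+1; split => //=.
by rewrite /total_weight big_ord_recr/= addrC.
Qed.

Lemma total_weightE a t :
  total_weight a t.+1 = t.+1%:R * \sum_k average (a k) t * C k.
Proof.
rewrite /total_weight /weight exchange_big mulr_sumr; apply: eq_bigr => k _ /=.
rewrite -mulr_suml /average.
under eq_bigr do rewrite mxE.
by field; rewrite addrC natr1 pnatr_eq0.
Qed.

(** Convergence in the scaled uniform topology controls the averages over all
   horizons simultaneously, which makes the regeneration times bounded. *)
Lemma regeneration_bounded u a : \sum_k mu k ord0 * C k < c ^+ 2 ->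
  (forall k, average (a k) @ \oo --> mu k ord0) -> DK_cvg u a ->
  exists S N : nat, forall n s, (N <= n)%N -> (1 <= s)%N ->
    c ^+ 2 * s.-1%:R <= total_weight (u n) s -> (s <= S)%N.
Proof.
move=> mulow amu ua.
pose SC := \sum_k C k.
have SC0 : 0 <= SC by apply: sumr_ge0 => k _; exact: ltW.
pose d := c ^+ 2 - \sum_k mu k ord0 * C k.
have d0 : 0 < d by rewrite subr_gt0.
pose e := d / (4 * (SC + 1)).
have e0 : 0 < e by rewrite divr_gt0// mulr_gt0// ltr_pwDr.
have hS : \forall t \near \oo, forall k, average (a k) t <= mu k ord0 + e.
  apply: filter_forall => k.
  have /cvgrPdist_le /(_ e e0) := amu k.
  by apply: filterS => t; rewrite ler_distlC => /andP[].
have hN : \forall n \near \oo, forall k, (scaled_norm (u n k \- a k)%R <= e%:E)%E.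
  apply: filter_forall => k.
  have /fine_cvgP[fin /cvgrPdist_le /(_ e e0) h] := ua k.
  near=> n.
  have : scaled_norm (u n k \- a k) \is a fin_num by near: n.
  move=> /fineK <-; rewrite lee_fin.
  have : `|0 - fine (scaled_norm (u n k \- a k))| <= e by near: n.
  by rewrite sub0r normrN; apply: le_trans; exact: ler_norm.
have [S _ hS'] := hS; have [N _ hN'] := hN.
pose S1 := Num.truncn (2 * c ^+ 2 / d).
exists (maxn S S1).+1, N => n s Nn; case: s => // t _ hle.
rewrite ltnS leqNgt; apply/negP => tS.
have St : (S <= t)%N by rewrite (leq_trans _ (ltnW tS))// leq_maxl.
have S1t : (S1 < t)%N by rewrite (leq_ltn_trans _ tS)// leq_maxr.
have avg k : average (u n k) t <= mu k ord0 + e + e.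
  have hu : `|average (u n k) t - average (a k) t| <= e.
    rewrite -lee_fin; apply: le_trans (hN' n Nn k).
    apply: le_trans (norm_average_le _ t).
    by rewrite lee_fin /average -mulrBl -sumrB.
  have := hS' t St k; move: hu; rewrite ler_distl => /andP[_]; lra.
have wle : \sum_k average (u n k) t * C k <= c ^+ 2 - d / 2.
  apply: (@le_trans _ _ (\sum_k (mu k ord0 * C k + 2 * e * C k))).
    apply: ler_sum => k _; rewrite -mulrDl ler_pM2r//.
    by apply: le_trans (avg k) _; lra.
  rewrite big_split/= -mulr_sumr -/SC.
  suff : 2 * e * SC <= d / 2 by rewrite /d; lra.
  rewrite /e; have -> : 2 * (d / (4 * (SC + 1))) * SC = d / 2 * (SC / (SC + 1)).
    by field; rewrite gt_eqF// ltr_pwDr.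
  by rewrite ler_piMr ?divr_ge0 ?(ltW d0)// ler_pdivrMr ?mul1r ?lerDl// ltr_pwDr.
move: hle; rewrite total_weightE /= => hle.
have t1 : (0 : R) <= t.+1%:R by [].
have := ler_wpM2l t1 wle.
have : 2 * c ^+ 2 / d < t%:R.
  by apply: lt_le_trans (truncnS_gt _) _; rewrite ler_nat.
rewrite ltr_pdivrMr//.
move: hle; rewrite -natr1; lra.
Unshelve. all: by end_near. Qed.

Lemma entry_le (x : nat -> R) i e : (scaled_norm x <= e%:E)%E ->
  `|x i| <= 2 * i.+1%:R * e.
Proof.
move=> xe.
have av n : `|average x n| <= e.
  by rewrite -lee_fin (le_trans _ xe)// norm_average_le.
have e0 : 0 <= e by exact: le_trans (av 0%N).
have s n : `|\sum_(j < n) x j| <= n%:R * e.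
  case: n => [|n]; first by rewrite big_ord0 normr0 mul0r.
  have := av n; rewrite /average normrM [X in _ * X]ger0_norm// ler_pdivrMr// mulrC.
  by [].
have -> : x i = \sum_(j < i.+1) x j - \sum_(j < i) x j.
  by rewrite big_ord_recr/= addrAC subrr add0r.
apply: le_trans (ler_normB _ _) _.
have := s i.+1; have := s i; rewrite -natr1; lra.
Qed.

Lemma DK_cvg_entry u (a : 'I_K -> nat -> R) k i : DK_cvg u a -> (fun n => u n k i) @ \oo --> a k i.
Proof.
move=> ua; apply/cvgrPdist_le => e e0.
have e'0 : 0 < e / (2 * i.+1%:R) by rewrite divr_gt0// mulr_gt0.
have /fine_cvgP[fin /cvgrPdist_le /(_ _ e'0) h] := ua k.
near=> n.
have fn : scaled_norm (u n k \- a k) \is a fin_num by near: n.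
have hn : `|0 - fine (scaled_norm (u n k \- a k))| <= e / (2 * i.+1%:R) by near: n.
have le1 : (scaled_norm (u n k \- a k)%R <= (e / (2 * i.+1%:R))%:E)%E.
  rewrite -(fineK fn) lee_fin; apply: le_trans hn.
  by rewrite sub0r normrN ler_norm.
have := entry_le i le1; rewrite /= distrC => /le_trans; apply.
by rewrite mulrC divfK// mulf_neq0// pnatr_eq0.
Unshelve. all: by end_near. Qed.

Lemma infinitely_often (Q : nat -> nat -> Prop) (S N : nat) :
  (forall n, (N <= n)%N -> exists2 s, (s <= S)%N & Q s n) ->
  exists2 s, (s <= S)%N & forall m, exists2 n, (m <= n)%N & Q s n.
Proof.
elim: S N => [|S IH] N h.
  exists 0%N => // m; have [s] := h _ (leq_maxl N m).
  by rewrite leqn0 => /eqP -> ?; exists (maxn N m) => //; exact: leq_maxr.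
have [h'|/existsNP[M hM]] := pselect (forall m, exists2 n, (m <= n)%N & Q S.+1 n).
  by exists S.+1.
have [n Mn|s sS hs] := IH (maxn N M).
  have [] := h n; first by rewrite (leq_trans _ Mn)// leq_maxl.
  move=> s; rewrite leq_eqVlt => /predU1P[-> q|sS q]; last by exists s.
  by case: hM; exists n => //; rewrite (leq_trans _ Mn)// leq_maxr.
by exists s => //; rewrite leqW.
Qed.

Variable Ls : 'I_K -> R -> \bar R.
Hypothesis Ls_ge0 : forall k x, (0 <= Ls k x)%E.

Lemma Isharp_recent t a : (Isharp_fin Ls (recent t a) <= Isharp_inf Ls a)%E.
Proof.
apply: lee_sum => k _.
apply: le_trans (nneseries_lim_ge t _); last by [].
by rewrite big_mkord; under eq_bigr do rewrite mxE.
Qed.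

(** A subsequence regenerates at one fixed index [s], where the infinite
   horizon map coincides with the finite horizon map; the truncation of the
   limit path to this horizon is then at least as cheap. *)
Lemma I_rate_le_J b : \sum_k mu k ord0 * C k < c ^+ 2 ->
  (forall a, DK_space mu a -> cvgn (fun t => G_fin Hwc (recent t a))) ->
  (ereal_inf [set I_rate Ls Hwc t b | t in [set t | (1 <= t)%N]] <=
   J_rate Ls Hwc mu b)%E.
Proof.
move=> mulow CH; apply/le_ereal_inf_tmp => _ [a [aD [u [uD ua ub]]] <-].
have [|S [N hSN]] := regeneration_bounded mulow _ ua.
  by move=> k; have [] := aD k.
have u0 n k i : 0 <= u n k i by have [] := uD n k.
(* the limit belongs to the finite, hence closed, set of regenerated values *)
have Gs n : (N <= n)%N -> exists2 s, (s <= S)%N &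
    (1 <= s)%N /\ G_inf Hwc (u n) = run Hwc (u n) s 0.
  move=> Nn; pose D := [set run Hwc (u n) s 0 | s in [set s | (1 <= s <= S)%N]].
  have Dcl : closed D.
    have [acc _] := @accessible_finite_set_closed 'cV[R]_K.
    apply: acc; first by apply: hausdorff_accessible; exact: norm_hausdorff.
    apply: finite_image; apply: (@sub_finite_set _ _ `I_S.+1) => //.
    by move=> s /=/andP[].
  have : D (G_inf Hwc (u n)).
    apply: (@closed_cvg _ _ _ _ _ D Dcl _ _ (CH _ (uD n))).
    exists 1%N => // t /= t1; rewrite G_fin_recent.
    have [s [/andP[s1 st] -> hs]] := run0_regenerates (u0 n) t1.
    by exists s => //=; rewrite s1 (hSN n).
  by move=> [s /= /andP[s1 sS] <-]; exists s.
have [s sS hs] := infinitely_often Gs.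
have s1 : (1 <= s)%N by have [n _ []] := hs 0%N.
have [f hf] := choice (fun m => (let: ex_intro2 n a b := hs m in
  ex_intro (fun n => (m <= n)%N /\ _) n (conj a b))).
have finf : f @ \oo --> \oo.
  apply/cvgnyPge => A; exists A => // m /= Am.
  by rewrite (leq_trans Am)//; have [] := hf m.
apply: ge_ereal_inf; exists (I_rate Ls Hwc s b); first by exists s.
apply: le_trans (Isharp_recent s a).
apply: ereal_inf_lbound; exists (recent s a) => //; split.
  by move=> k i; rewrite mxE; have [] := aD k.
exists (fun m => recent s (u (f m))); split.
- by move=> m k i; rewrite mxE.
- apply: cvg_mx => k i; rewrite mxE.
  rewrite (_ : (fun m => _) = (fun n => u n k i) \o f); last first.
    by apply/funext => m; rewrite /= mxE.
  exact: (cvg_comp _ _ finf (@DK_cvg_entry u a k i ua)).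
- rewrite (_ : _ \o _ = (G_inf Hwc \o u) \o f); last first.
    by apply/funext => m /=; rewrite G_fin_recent; have [_ [_ ->]] := hf m.
  exact: (cvg_comp _ _ finf ub).
Qed.

End regeneration.

(** * Sequences with prescribed averages *)

Section averages.
Context {R : realType}.

Lemma bounded_over_cvg0 (b : nat -> R) M : (forall n, `|b n| <= M) ->
  (fun n => b n / n.+1%:R) @ \oo --> 0.
Proof.
move=> bM; apply/cvgr0Pnorm_le => e e0.
have Mh : (fun n => M * harmonic n) @ \oo --> M * 0 by apply: cvgMr; exact: cvg_harmonic.
rewrite mulr0 in Mh; have /cvgr0Pnorm_le /(_ e e0) := Mh.
apply: filterS => n; apply: le_trans.
rewrite !normrM /harmonic/= ler_wpM2r// (le_trans (bM n))// ler_norm//.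
Qed.

Lemma averageD (x y : nat -> R) : average (x \+ y) = average x \+ average y.
Proof. by apply/funext => n /=; rewrite /average big_split/= mulrDl. Qed.

Lemma averageZ a (x : nat -> R) n : average (fun m => a * x m) n = a * average x n.
Proof. by rewrite /average -mulr_sumr mulrA. Qed.

Lemma average_telescope (V : nat -> R) M : (forall n, `|V n| <= M) ->
  average (fun n => V n - V n.+1) @ \oo --> 0.
Proof.
move=> VM; have -> : average (fun n => V n - V n.+1) =
    (fun n => (V 0%N - V n.+1) / n.+1%:R).
  apply/funext => n; rewrite /average; congr (_ / _).
  rewrite -(big_mkord xpredT (fun i => V i - V i.+1)).
  rewrite (@telescope_sumr_eq _ _ _ (fun i => - V i))//.
    by rewrite opprK addrC.
  by move=> i _; rewrite opprK addrC.
apply: (@bounded_over_cvg0 _ (M + M)) => n.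
by apply: le_trans (ler_normB _ _) _; exact: lerD.
Qed.

(** Always choosing the item that lags most behind its target keeps all lags
   bounded: none falls below [-1], and they sum to zero. *)
Lemma prescribed_frequencies (K : nat) (p : 'I_K -> R) (k0 : 'I_K) :
  (forall k, 0 <= p k) -> \sum_k p k = 1 ->
  exists tau : nat -> 'I_K,
    forall k, average (fun m => (tau m == k)%:R) @ \oo --> p k.
Proof.
move=> p0 p1.
pose pick (D : 'I_K -> R) := [arg max_(i > k0) (D i + p i)]%O.
pose D := fix D t : 'I_K -> R := if t is s.+1 then
  (fun k => D s k + p k - (pick (D s) == k)%:R) else (fun=> 0).
exists (fun m => pick (D m)) => k.
have Dsum t : \sum_k D t k = 0.
  elim: t => [|t IH] /=; first by rewrite big1.
  rewrite big_split big_split/= IH p1 sumrN (bigD1 (pick (D t)))//= eqxx big1.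
    by rewrite addr0 add0r subrr.
  by move=> i; rewrite eq_sym => /negbTE ->.
have Dge t i : -1 <= D t i.
  elim: t i => [|t IH] i /=; first by rewrite oppr_le0.
  case: eqVneq => [<-|_]; last by rewrite subr0 (le_trans (IH i))// lerDl.
  rewrite -[leLHS]add0r lerD2r.
  rewrite leNgt; apply/negP => lt0.
  have : \sum_i (D t i + p i) < 0.
    apply: (@lt_le_trans _ _ (\sum_(i < K) 0)); last by rewrite big1.
    apply: ltr_sum.
      by apply/hasP; exists k0 => //; exact: mem_index_enum.
    move=> m _; apply: le_lt_trans lt0.
    by rewrite /pick; case: arg_maxP => //= l _ ->.
  by rewrite big_split/= Dsum p1 add0r ltr10.
have Dbd t i : `|D t i| <= K%:R.
  rewrite ler_norml; apply/andP; split.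
    by apply: le_trans (Dge t i); rewrite lerN2 ler1n (leq_ltn_trans _ (ltn_ord k0)).
  have := Dsum t; rewrite (bigD1 i)//= => /eqP.
  rewrite addr_eq0 => /eqP ->; rewrite -sumrN.
  apply: (@le_trans _ _ (\sum_(l < K | l != i) 1)).
    by apply: ler_sum => l _; rewrite lerNl.
  by rewrite sumr_const ler_nat -[leqRHS]card_ord max_card.
have DE t : D t k = t%:R * p k - \sum_(m < t) (pick (D m) == k)%:R.
  elim: t => [|t IH]; first by rewrite mul0r big_ord0 subrr.
  by rewrite /= IH big_ord_recr/= -[t.+1%:R]natr1; ring.
have -> : average (fun m => (pick (D m) == k)%:R) =
    (fun n => p k - D n.+1 k / n.+1%:R).
  apply/funext => n; rewrite /average DE.
  by field; rewrite addrC natr1 pnatr_eq0.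
rewrite -[X in _ --> X]subr0; apply: cvgB; first exact: cvg_cst.
exact: (@bounded_over_cvg0 _ K%:R).
Qed.

(** The sparse part of the bound allows for the slots where an itinerary has to
   deviate from the prescribed frequencies. *)
Lemma average_sparse (f g : nat -> R) (sp : nat -> bool) (M : R) :
  0 <= M -> (forall n, `|f n| <= g n + M * (sp n)%:R) ->
  g @ \oo --> 0 -> average (fun n => (sp n)%:R) @ \oo --> (0 : R) ->
  average f @ \oo --> 0.
Proof.
move=> M0 fg g0 sp0; apply/cvgr0Pnorm_le => e e0.
have h : average (g \+ (fun n => M * (sp n)%:R)) @ \oo --> 0 + M * 0.
  rewrite averageD; apply: cvgD; first by rewrite average_mean; exact: cesaro.
  rewrite (_ : average _ = fun n => M * average (fun m => (sp m)%:R) n).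
    exact: cvgMr.
  by apply/funext => n; rewrite averageZ.
rewrite mulr0 addr0 in h; have /cvgr0Pnorm_le /(_ e e0) := h.
apply: filterS => n; apply: le_trans.
rewrite /average !normrM ler_wpM2r//.
apply: le_trans (ler_norm_sum _ _ _) _; apply: le_trans (ler_norm _).
by apply: ler_sum.
Qed.

Lemma trunc_log_sqr n : (trunc_log 2 n ^ 2 <= 4 * n)%N.
Proof.
case: n => [|n]; first by rewrite trunc_log0.
have := trunc_logP (isT : (1 < 2)%N) (isT : (0 < n.+1)%N).
set i := trunc_log 2 n.+1 => hi.
apply: leq_trans (_ : 4 * 2 ^ i <= _)%N; last by rewrite leq_mul2l.
have hh : (i <= 2 * 2 ^ (i./2))%N.
  rewrite -{1}(odd_double_half i) -mul2n.
  have := ltn_expl i./2 (isT : (1 < 2)%N); case: (odd i) => /=; lia.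
apply: leq_trans (_ : (2 * 2 ^ (i./2)) ^ 2 <= _)%N; first by rewrite leq_exp2r.
rewrite expnMn -expnM leq_mul2l/= leq_exp2l//; lia.
Qed.

Lemma trunc_log_over_cvg0 (a b d : nat) :
  (fun n => (a * (trunc_log 2 (b + n.+1)).+1 + d)%:R / n.+1%:R) @ \oo --> (0 : R).
Proof.
have tl : (fun n => (trunc_log 2 (b + n.+1))%:R / n.+1%:R) @ \oo --> (0 : R).
  apply/cvgr0Pnorm_le => e e0.
  pose M := Num.truncn (4 * (b.+1)%:R / e ^+ 2).
  exists M.+1 => // n /= Mn.
  rewrite ger0_norm// ler_pdivrMr// leNgt; apply/negP => h.
  have e2 : 0 < e ^+ 2 by rewrite exprn_gt0.
  have h1 : 4 * (b.+1)%:R / e ^+ 2 < n.+1%:R.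
    by apply: lt_le_trans (truncnS_gt _) _; rewrite ler_nat leqW.
  rewrite ltr_pdivrMr// in h1.
  have h2 : (e * n.+1%:R) ^+ 2 < (trunc_log 2 (b + n.+1))%:R ^+ 2.
    by rewrite ltr_sqr ?nnegrE// mulr_ge0// ltW.
  have h3 : (trunc_log 2 (b + n.+1))%:R ^+ 2 <= 4 * (b.+1)%:R * n.+1%:R :> R.
    rewrite -natrX -!natrM ler_nat; apply: leq_trans (trunc_log_sqr _) _; nia.
  have n0 : 0 < n.+1%:R :> R by [].
  have h4 : 4 * (b.+1)%:R * n.+1%:R < n.+1%:R * e ^+ 2 * n.+1%:R.
    by rewrite ltr_pM2r.
  move: (lt_le_trans h2 h3); rewrite exprMn; lra.
have h1 : (fun n => (a%:R : R) * ((trunc_log 2 (b + n.+1))%:R / n.+1%:R)) @ \oo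
    --> a%:R * (0 : R) by exact: cvgMr.
have h2 : (fun n => (a + d)%:R / n.+1%:R) @ \oo --> (0 : R).
  by apply: (@bounded_over_cvg0 _ (a + d)%:R) => n; rewrite ger0_norm.
have -> : (fun n => (a * (trunc_log 2 (b + n.+1)).+1 + d)%:R / n.+1%:R) =
    (fun n => a%:R * ((trunc_log 2 (b + n.+1))%:R / n.+1%:R) +
      (a + d)%:R / n.+1%:R) :> (nat -> R).
  apply/funext => n /=.
  rewrite mulnS natrD natrD natrM natrD.
  by field; rewrite addrC natr1 pnatr_eq0.
have := cvgD h1 h2; rewrite mulr0 addr0; exact.
Qed.

End averages.

(** * An itinerary that never regenerates *)

Section dyadic_phase.

Definition scale (q : nat) := trunc_log 2 q.
Definition phase (q : nat) := (q - 2 ^ scale q)%N.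

Lemma phaseK q : (0 < q)%N -> q = (2 ^ scale q + phase q)%N.
Proof. by move=> q0; rewrite /phase subnKC// trunc_logP. Qed.

Lemma phase_lt q : (0 < q)%N -> (phase q < 2 ^ scale q)%N.
Proof.
move=> q0; have := trunc_log_ltn q (isT : (1 < 2)%N).
by rewrite -/(scale q) {1}(phaseK q0) expnS mul2n -addnn ltn_add2l.
Qed.

Lemma scale_eq i r : (r < 2 ^ i)%N -> scale (2 ^ i + r) = i.
Proof.
move=> ri; apply: trunc_log_eq => //.
by rewrite leq_addr/= expnS mul2n -addnn ltn_add2l.
Qed.

Lemma phase_eq i r : (r < 2 ^ i)%N -> phase (2 ^ i + r) = r.
Proof. by move=> ri; rewrite /phase scale_eq// addKn. Qed.

Lemma scale_le p q : (p <= q)%N -> (scale p <= scale q)%N.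
Proof. exact: leq_trunc_log. Qed.

Lemma phaseS q : (0 < q)%N ->
  (phase q.+1 = 0%N /\ scale q.+1 = (scale q).+1 /\ (phase q).+1 = 2 ^ scale q)%N \/
  (phase q.+1 = (phase q).+1 /\ scale q.+1 = scale q).
Proof.
move=> q0; have := phase_lt q0; rewrite leq_eqVlt => /predU1P[e|lt].
  left; have qE : q.+1 = (2 ^ (scale q).+1 + 0)%N.
    by rewrite {1}(phaseK q0) -addnS e expnS mul2n -addnn addn0.
  by rewrite qE phase_eq ?expn_gt0// scale_eq ?expn_gt0.
by right; rewrite {1 3}(phaseK q0) -addnS phase_eq// scale_eq.
Qed.

End dyadic_phase.

(** Arrivals are built together with the workload they produce, slot by slot:
   [before q] is the workload before slot [q], [after q] what this slot leaves
   of it, and the arrivals in slot [q.+1] make up the difference between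
   [after q.+1] and [before q].  Slots run downwards, towards the present.

   In an ordinary slot one package is served.  A package of a queue with the
   smallest capacity [c = C k1] has size [c]; one such package, the resident, is
   always waiting, so that the workload is outside the box where the scheduler
   projects.  A package of another queue [k], of size [alpha k], is just large
   enough to be preferred to the resident.  In addition queue [k1] holds a small
   amount [lev q], without which the workload would be in the simplex and
   regenerate.

   The packages have to exceed their sizes by a multiple of this amount, which
   therefore has to vanish in the remote past: it is halved at each power of
   two.  The slots after these times are used to make the workloads started
   there differ.  In the slots of phase [N.+1] and [N], queue [k1] holds almost
   an additional package, and then a full one, and in the latter slot a package
   of size [x] of queue [j] competes with it.  A workload started just before
   this slot lies lower by almost [c] and serves this package at once; the older
   workloads prefer queue [k1], which puts them slightly below the new one, at
   the price of a backlog [x] in queue [j].  In the slots of phase less than [N]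
   further packages of size [x] make queue [j] waste capacity until the backlog
   has disappeared. *)
Section itinerary.
Context {R : realType} {K : nat}.
Variables (C : 'I_K -> R) (k1 j : 'I_K) (alpha : 'I_K -> R) (eta x : R).
Variables (N : nat) (tau0 : nat -> 'I_K).
Local Notation c := (C k1).
Hypothesis C0 : forall k, 0 < C k.
Hypothesis Cmin : forall k, c <= C k.
Hypothesis cj : c < C j.
Hypothesis alpha_light : forall k, C k = c -> alpha k = c.
Hypothesis alpha_heavy : forall k, c < C k ->
  c ^+ 2 <= C k * alpha k /\ alpha k + 2 * eta <= C k.
Hypothesis eta0 : 0 < eta.
Hypothesis eta_c : 4 * eta <= c.
(* A package of size [x] is preferred to workloads just above [c], but not to
   [2 * c], and [N] of them erase a backlog of size [x]. *)
Hypothesis x_gt : c * (c + 3 * eta) < C j * x.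
Hypothesis x_lt : C j * x < 2 * c ^+ 2.
Hypothesis x_Cj : x < C j.
Hypothesis x_N : x <= N%:R * (C j - x).

Definition lev (q : nat) : R := eta / 2 ^+ scale q.

(** The slots where the type of the package cannot be chosen: the level changes,
   and their neighbours, where the resident must be in queue [k1]. *)
Definition forced q := (phase q <= N.+2)%N || (phase q.+1 == 0)%N.

Definition tau q := if forced q then k1 else tau0 q.

Definition heavy k := c < C k.

(** The queue of the resident, which is the next package of smallest capacity
   to be served. *)
Fixpoint res q : 'I_K :=
  if heavy (tau q) then (if q is p.+1 then res p else k1) else tau q.

Definition backlog (m : nat) : R := Num.max 0 (x - m%:R * (C j - x)).

(** Up to phase [N] the level is already that of the next scale towards the
   present, which is [2 * lev q]. *)
Definition before q (k : 'I_K) : R :=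
  if (phase q < N)%N then
    (k == k1)%:R * (c + 2 * lev q) +
    (k == j)%:R * (backlog (N - (phase q).+1) + x)
  else if phase q == N then
    (k == k1)%:R * (2 * c + 2 * lev q) + (k == j)%:R * x
  else if phase q == N.+1 then (k == k1)%:R * (2 * c - lev q)
  else (k == k1)%:R * lev q + (k == res q)%:R * c +
       ((k == tau q) && heavy (tau q))%:R * (alpha (tau q) + 2 * lev q).

Definition after q (k : 'I_K) : R :=
  if (phase q < N)%N then
    (k == k1)%:R * (c + 2 * lev q) + (k == j)%:R * backlog (N - phase q)
  else if phase q == N then
    (k == k1)%:R * (c + 2 * lev q) + (k == j)%:R * x
  else if phase q == N.+1 then (k == k1)%:R * (c - lev q)
  else (k == k1)%:R * lev q + ((k == res q) && heavy (tau q))%:R * c.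

(** How far a workload may be from the itinerary in queue [k1]. *)
Definition window q : R := if (phase q <= N.+1)%N then lev q else lev q / 2.

Let c0 : 0 < c. Proof. exact: C0. Qed.

Let k1j : k1 != j. Proof. by apply/eqP => e; move: cj; rewrite e ltxx. Qed.

Let jk1 : j != k1. Proof. by rewrite eq_sym. Qed.

Let x0 : 0 < x.
Proof.
rewrite -(pmulr_rgt0 _ (C0 j)); apply: lt_trans x_gt.
rewrite mulr_gt0//; have := c0; have := eta0; lra.
Qed.

Lemma N_gt0 : (0 < N)%N.
Proof.
rewrite lt0n; apply/eqP => N0; move: x_N; rewrite N0 mul0r.
by rewrite leNgt x0.
Qed.

Lemma lev_gt0 q : 0 < lev q.
Proof. by rewrite divr_gt0// exprn_gt0. Qed.

Lemma lev_le q : lev q <= eta.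
Proof.
rewrite ler_pdivrMr ?exprn_gt0// ler_peMr ?(ltW eta0)//.
by rewrite exprn_ege1// ler1n.
Qed.

Lemma lev_scaleS p q : scale q = (scale p).+1 -> lev p = 2 * lev q.
Proof.
rewrite /lev => ->; rewrite exprS; field.
by rewrite expf_neq0.
Qed.

Lemma backlog_ge0 m : 0 <= backlog m.
Proof. by rewrite le_max lexx. Qed.

Lemma backlog_le m : backlog m <= x.
Proof.
by rewrite ge_max ltW//= lerBlDr lerDl mulr_ge0// subr_ge0 ltW.
Qed.

Lemma backlog0 : backlog 0 = x.
Proof. by rewrite /backlog mul0r subr0; apply/max_idPr; exact: ltW. Qed.

Lemma backlog_end : backlog N = 0.
Proof. by apply/max_idPl; rewrite subr_le0. Qed.

(** Serving packages of size [x] repeatedly wastes capacity, which eats up the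
   backlog. *)
Lemma backlogS m : Num.max 0 (backlog m + x - C j) = backlog m.+1.
Proof.
rewrite /backlog -natr1; have := x_Cj => h.
have [h1|h1] := leP 0 (x - m%:R * (C j - x)).
  by congr Num.max; ring.
rewrite (max_idPl _); last by lra.
rewrite (max_idPl _)//; lra.
Qed.

Lemma res_light q : C (res q) = c.
Proof.
suff : ~~ heavy (res q).
  by rewrite /heavy -leNgt => h; apply/eqP; rewrite eq_le h Cmin.
have k1l : ~~ heavy k1 by rewrite /heavy ltxx.
elim: q => [|q IH] /=; first by case: ifP => // /negbT.
by case: ifP => // /negbT.
Qed.

Lemma lightP k : ~~ heavy k -> C k = c.
Proof. by rewrite /heavy -leNgt => h; apply/eqP; rewrite eq_le h Cmin. Qed.

Lemma res_light_slot q : ~~ heavy (tau q) -> res q = tau q.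
Proof. by case: q => [|q] /= /negbTE ->. Qed.

Lemma res_heavy_slot q : heavy (tau q.+1) -> res q.+1 = res q.
Proof. by move=> /= ->. Qed.

Lemma tau_forced q : forced q -> tau q = k1.
Proof. by rewrite /tau => ->. Qed.

Lemma heavyk1 : heavy k1 = false. Proof. by rewrite /heavy ltxx. Qed.

Lemma res_forced q : forced q -> res q = k1.
Proof. by move=> fq; rewrite res_light_slot tau_forced// heavyk1. Qed.

Variables (H Hwc : 'cV[R]_K -> 'cV[R]_K).
Hypothesis mwH : max_weight C H.
Hypothesis wcH : work_conserving C H Hwc.

Lemma serve (f g : 'I_K -> R) (s m : 'I_K) : (forall k, 0 <= f k) -> C m <= f m ->
  (forall k, k != s -> C k * f k < C s * f s) ->
  (forall k, g k = if k == s then Num.max 0 (f s - C s) else f k) ->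
  leftover Hwc (\col_k f k) = \col_k g k.
Proof.
move=> f0 fm fs gE.
rewrite (leftover_argmax (j := s) (k := m) C0 mwH wcH) ?mxE//.
- by apply/colP => k; rewrite !mxE gE.
- by move=> k i; rewrite mxE.
- by move=> k ks; rewrite !mxE; exact: fs.
Qed.

(** The scheduler follows the itinerary even when queue [k1] is off by a small
   amount, and then this amount is kept unchanged. *)
Definition follows q (s : R) := leftover Hwc (\col_k (before q k + (k == k1)%:R * s)) =
  \col_k (after q k + (k == k1)%:R * s).

Lemma follows_erasing q (s : R) : (phase q < N)%N -> `|s| <= lev q -> follows q s.
Proof.
move=> pN; rewrite ler_norml => /andP[s1 s2].
have l0 := lev_gt0 q; have le := lev_le q; have c1 := c0; have xp := x0.
have xc := x_Cj; have b0 := backlog_ge0 (N - (phase q).+1).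
rewrite /follows /before /after pN.
apply: (@serve _ _ j k1) => [k||k kj|k].
- by case: eqVneq => _; case: eqVneq => _; rewrite ?mul1r ?mul0r; lra.
- rewrite eqxx (negbTE k1j) !mul1r mul0r; lra.
- rewrite eqxx (negbTE jk1) (negbTE kj) !mul0r !mul1r add0r !addr0.
  apply: (@lt_le_trans _ _ (C j * x)); last by rewrite ler_pM2l//; lra.
  case: eqVneq => [->|_]; last by rewrite !mul0r addr0 mulr0 mulr_gt0.
  rewrite !mul1r; apply: le_lt_trans x_gt; rewrite ler_pM2l//; lra.
- case: (eqVneq k j) => [->|kj]; last by rewrite !mul0r.
  rewrite eqxx (negbTE jk1) !mul0r !mul1r !add0r !addr0 backlogS.
  by rewrite -subSn// subSS.
Qed.

Lemma follows_dividing q (s : R) : phase q = N -> `|s| <= lev q -> follows q s.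
Proof.
move=> pN; rewrite ler_norml => /andP[s1 s2].
have l0 := lev_gt0 q; have c1 := c0; have xp := x0.
rewrite /follows /before /after pN ltnn eqxx.
apply: (@serve _ _ k1 k1) => [k||k kk|k].
- by case: eqVneq => _; case: eqVneq => _; rewrite ?mul1r ?mul0r; lra.
- rewrite eqxx (negbTE k1j) !mul1r mul0r; lra.
- rewrite eqxx (negbTE k1j) (negbTE kk) !mul0r !mul1r add0r !addr0.
  apply: (@lt_le_trans _ _ (2 * c ^+ 2)); last first.
    have : 0 <= c * (2 * lev q + s) by rewrite mulr_ge0//; lra.
    rewrite expr2; lra.
  case: eqVneq => [->|_]; first by rewrite mul1r.
  by rewrite mul0r mulr0 mulr_gt0// exprn_gt0.
- case: (eqVneq k k1) => [->|kk]; last by rewrite !mul0r.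
  rewrite eqxx (negbTE k1j) !mul1r !mul0r (max_idPr _); lra.
Qed.

Lemma follows_raised q (s : R) : phase q = N.+1 -> `|s| <= lev q -> follows q s.
Proof.
move=> pN; rewrite ler_norml => /andP[s1 s2].
have l0 := lev_gt0 q; have le := lev_le q; have c1 := c0; have ec := eta_c.
rewrite /follows /before /after pN ltnNge leqnSn/= gtn_eqF// eqxx.
apply: (@serve _ _ k1 k1) => [k||k kk|k].
- by case: eqVneq => _; rewrite ?mul1r ?mul0r; lra.
- rewrite eqxx !mul1r; lra.
- rewrite eqxx (negbTE kk) !mul0r !mul1r add0r mulr0 mulr_gt0//; lra.
- case: (eqVneq k k1) => [_|kk]; last by rewrite !mul0r.
  rewrite eqxx !mul1r (max_idPr _); lra.
Qed.

Lemma follows_light q (s : R) : (N.+1 < phase q)%N -> ~~ heavy (tau q) ->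
  `|s| <= lev q / 2 -> follows q s.
Proof.
move=> Np lt; rewrite ler_norml => /andP[s1 s2].
have l0 := lev_gt0 q; have le := lev_le q; have c1 := c0; have ec := eta_c.
rewrite /follows /before /after ltnNge (ltnW (ltnW Np))/= gtn_eqF ?(ltnW Np)//.
rewrite gtn_eqF// (negbTE lt); have Ct := lightP lt; rewrite (res_light_slot lt).
apply: (@serve _ _ (tau q) (tau q)) => [k||k kt|k].
- rewrite andbF; case: eqVneq => _; case: eqVneq => _; rewrite ?mul1r ?mul0r; lra.
- rewrite andbF eqxx Ct; case: eqVneq => _; rewrite ?mul1r ?mul0r; lra.
- rewrite !andbF eqxx (negbTE kt) Ct !mul0r addr0 mul1r.
  case: eqVneq => [->|_]; case: eqVneq => _;
    rewrite ?mul1r ?mul0r ?add0r ?addr0 ?mulr0; rewrite ?mulr_gt0 ?ltr_pM2l//; lra.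
- rewrite !andbF; case: (eqVneq k (tau q)) => [->|kt].
    rewrite eqxx Ct; case: eqVneq => _; rewrite !mul1r ?mul0r (max_idPr _); lra.
  by rewrite !mul0r !addr0.
Qed.

Lemma follows_heavy q (s : R) : (N.+1 < phase q)%N -> heavy (tau q) ->
  `|s| <= lev q / 2 -> follows q s.
Proof.
move=> Np hv; rewrite ler_norml => /andP[s1 s2].
have l0 := lev_gt0 q; have le := lev_le q; have c1 := c0; have ec := eta_c.
rewrite /follows /before /after ltnNge (ltnW (ltnW Np))/= gtn_eqF ?(ltnW Np)//.
rewrite gtn_eqF// hv; have rl := res_light q.
have tk : (tau q == k1) = false by apply/negP => /eqP e; move: hv; rewrite e heavyk1.
have tr : (tau q == res q) = false.
  by apply/negP => /eqP e; move: hv; rewrite /heavy e rl ltxx.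
have [ca ac] := alpha_heavy hv.
have Ct : c < C (tau q) by exact: hv.
have a0 : 0 < alpha (tau q).
  by rewrite -(pmulr_rgt0 _ (C0 (tau q))) (lt_le_trans _ ca)// exprn_gt0.
have big : c ^+ 2 + c * (2 * lev q) <= C (tau q) * (alpha (tau q) + 2 * lev q).
  rewrite mulrDr lerD// ler_pM2r//; lra.
apply: (@serve _ _ (tau q) (res q)) => [k||k kt|k].
- rewrite andbT; set T := _ * (alpha _ + _); have T0 : 0 <= T.
    by rewrite mulr_ge0//; lra.
  by case: eqVneq => _; case: eqVneq => _; rewrite ?mul1r ?mul0r; lra.
- rewrite andbT eqxx rl [res q == tau q]eq_sym tr; case: eqVneq => _;
    rewrite ?mul1r ?mul0r; lra.
- rewrite !andbT eqxx (negbTE kt) tk tr !mul0r !add0r !addr0 mul1r.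
  apply: lt_le_trans big.
  have cl : 0 < c * lev q by rewrite mulr_gt0.
  have cc : 0 < c ^+ 2 by rewrite exprn_gt0.
  have cs : c * s <= c * (lev q / 2) by rewrite ler_pM2l.
  have cle : c * lev q <= c * eta.
    by rewrite ler_pM2l.
  have cec : c * (4 * eta) <= c * c by rewrite ler_pM2l.
  case: (eqVneq k k1) => [->|kk1].
    by case: eqVneq => _; rewrite ?mul1r ?mul0r ?addr0; lra.
  case: (eqVneq k (res q)) => [->|_].
    by rewrite rl !mul0r add0r addr0 mul1r; lra.
  by rewrite !mul0r !addr0 mulr0; lra.
- rewrite !andbT; case: (eqVneq k (tau q)) => [->|kt].
    rewrite tk tr eqxx !mul0r !mul1r (max_idPl _); lra.
  by rewrite mul0r addr0.
Qed.

Lemma leftover_before q (s : R) : `|s| <= window q -> follows q s.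
Proof.
rewrite /window; have [pN|pN] := leqP (phase q) N.+1; last first.
  by have [hv|lt] := boolP (heavy (tau q)); [exact: follows_heavy|exact: follows_light].
move: pN; rewrite leq_eqVlt => /predU1P[pN|]; first exact: follows_raised.
rewrite ltnS leq_eqVlt => /predU1P[pN|pN]; first exact: follows_dividing.
exact: follows_erasing.
Qed.

Lemma beforeE1 q k : (phase q < N)%N -> before q k =
  (k == k1)%:R * (c + 2 * lev q) +
  (k == j)%:R * (backlog (N - (phase q).+1) + x).
Proof. by rewrite /before => ->. Qed.

Lemma beforeE2 q k : phase q = N -> before q k =
  (k == k1)%:R * (2 * c + 2 * lev q) + (k == j)%:R * x.
Proof. by rewrite /before => ->; rewrite ltnn eqxx. Qed.

Lemma beforeE3 q k : phase q = N.+1 -> before q k = (k == k1)%:R * (2 * c - lev q).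
Proof. by rewrite /before => ->; rewrite ltnNge leqnSn/= gtn_eqF// eqxx. Qed.

Lemma beforeE4 q k : (N.+1 < phase q)%N -> before q k =
  (k == k1)%:R * lev q + (k == res q)%:R * c +
  ((k == tau q) && heavy (tau q))%:R * (alpha (tau q) + 2 * lev q).
Proof.
move=> Nq; rewrite /before ltnNge (ltnW (ltnW Nq))/= gtn_eqF ?(ltnW Nq)//.
by rewrite gtn_eqF.
Qed.

Lemma afterE1 q k : (phase q < N)%N -> after q k =
  (k == k1)%:R * (c + 2 * lev q) + (k == j)%:R * backlog (N - phase q).
Proof. by rewrite /after => ->. Qed.

Lemma afterE2 q k : phase q = N -> after q k =
  (k == k1)%:R * (c + 2 * lev q) + (k == j)%:R * x.
Proof. by rewrite /after => ->; rewrite ltnn eqxx. Qed.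

Lemma afterE3 q k : phase q = N.+1 -> after q k = (k == k1)%:R * (c - lev q).
Proof. by rewrite /after => ->; rewrite ltnNge leqnSn/= gtn_eqF// eqxx. Qed.

Lemma afterE4 q k : (N.+1 < phase q)%N -> after q k =
  (k == k1)%:R * lev q + ((k == res q) && heavy (tau q))%:R * c.
Proof.
move=> Nq; rewrite /after ltnNge (ltnW (ltnW Nq))/= gtn_eqF ?(ltnW Nq)//.
by rewrite gtn_eqF.
Qed.

Lemma before_forced q k : (N.+1 < phase q)%N -> forced q ->
  before q k = (k == k1)%:R * (c + lev q).
Proof.
move=> Nq fq; rewrite beforeE4// tau_forced// res_forced// heavyk1 andbF mul0r addr0.
by rewrite mulrDr addrC.
Qed.

Lemma after_forced q k : (N.+1 < phase q)%N -> forced q ->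
  after q k = (k == k1)%:R * lev q.
Proof.
by move=> Nq fq; rewrite afterE4// tau_forced// heavyk1 andbF mul0r addr0.
Qed.

Lemma lev_scale p q : scale p = scale q -> lev p = lev q.
Proof. by rewrite /lev => ->. Qed.

Lemma before_last q k : (0 < q)%N -> (N.+4 < 2 ^ scale q)%N -> phase q.+1 = 0%N ->
  before q k = (k == k1)%:R * (c + 2 * lev q.+1).
Proof.
move=> q0 Nq pq; have [[_ [sq pS]]|[pS _]] := phaseS q0; last by rewrite pq in pS.
rewrite before_forced ?(lev_scaleS sq)//.
  by move: Nq; rewrite -pS; clear; lia.
by rewrite /forced pq eqxx orbT.
Qed.

Lemma alpha_ge0 k : 0 <= alpha k.
Proof.
have [/alpha_light -> |Ck] := eqVneq (C k) c; first exact: ltW c0.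
have /alpha_heavy[ca _] : c < C k by rewrite lt_neqAle eq_sym Ck Cmin.
by rewrite -(pmulr_rge0 _ (C0 k)) (le_trans _ ca)// sqr_ge0.
Qed.

Lemma after_le_before q k : (0 < q)%N -> (N.+4 < 2 ^ scale q)%N ->
  after q.+1 k <= before q k.
Proof.
move=> q0 Nq; have l0 := lev_gt0 q; have le := lev_le q.
have c1 := c0; have ec := eta_c; have xp := x0.
have [[pq [sq pS]]|[pS sS]] := phaseS q0.
  rewrite (before_last k q0 Nq pq) afterE1 pq ?N_gt0// subn0 backlog_end.
  by rewrite mulr0 addr0.
have lS := lev_scale sS.
have [pN|] := ltnP (phase q).+1 N.
  rewrite afterE1 ?pS// beforeE1 ?(ltnW pN)// lS lerD2l ler_wpM2l//.
  by rewrite lerDl ltW.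
rewrite leq_eqVlt => /predU1P[pN|].
  rewrite afterE2 ?pS// beforeE1 ?pN// lS lerD2l ler_wpM2l//.
  by rewrite lerDr backlog_ge0.
rewrite ltnS leq_eqVlt => /predU1P[pN|].
  rewrite afterE3 ?pS ?pN// beforeE2// lS -[leLHS]addr0 lerD//.
    by rewrite ler_wpM2l//; lra.
  by rewrite mulr_ge0// ltW.
rewrite leq_eqVlt => /predU1P[pN|pN].
  rewrite beforeE3// after_forced ?pS -?pN// /forced ?pS -?pN ?leqnn// lS.
  by rewrite ler_wpM2l//; lra.
rewrite beforeE4// afterE4 ?pS ?ltnS ?(ltnW pN)// lS -addrA lerD2l.
have t0 : 0 <= ((k == tau q) && heavy (tau q))%:R * (alpha (tau q) + 2 * lev q).
  by rewrite mulr_ge0// addr_ge0 ?alpha_ge0// mulr_ge0// ltW.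
rewrite -[leLHS]addr0 lerD//.
case: (boolP (heavy (tau q.+1))) => hv; last by rewrite andbF mul0r mulr_ge0// ltW.
by rewrite andbT res_heavy_slot.
Qed.

Variable m0 : nat.
Hypothesis m0N : (N.+4 < 2 ^ m0)%N.

Definition bottom := (2 ^ m0 + N.+2)%N.

Definition tie := c * (c + lev bottom) / C j.

(** Index 0 is left without arrivals and the package [tie] is added at index 1:
   if queue [k1] is exactly on its itinerary then the two queues are tied
   before the last slot. *)
Definition itin (k : 'I_K) (m : nat) : R :=
  if m is p.+1 then before (bottom + p) k - after (bottom + p.+1) k +
    (p == 0%N)%:R * ((k == j)%:R * tie) else 0.

Let room i r : (N.+4 < 2 ^ i)%N -> (r <= N.+2)%N -> (r < 2 ^ i)%N.
Proof. by clear; lia. Qed.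

Let le_N2 : (N <= N.+2)%N. Proof. by clear; lia. Qed.
Let le_N12 : (N.+1 <= N.+2)%N. Proof. by clear; lia. Qed.

Lemma bottom_scale q : (bottom <= q)%N -> (N.+4 < 2 ^ scale q)%N.
Proof.
move=> bq; apply: leq_trans m0N _; rewrite leq_exp2l//.
by have := scale_le bq; rewrite /bottom scale_eq// (room m0N).
Qed.

Lemma bottom_gt0 : (0 < bottom)%N. Proof. by rewrite /bottom addnS. Qed.

Lemma bottom_phase : phase bottom = N.+2.
Proof. by rewrite /bottom phase_eq// (room m0N). Qed.

Lemma bottom_scaleE : scale bottom = m0.
Proof. by rewrite /bottom scale_eq// (room m0N). Qed.

Lemma tie_ge0 : 0 <= tie.
Proof.
have := lev_gt0 bottom; have := c0 => h1 h2.
by rewrite divr_ge0 ?mulr_ge0//; [lra|lra|exact: ltW].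
Qed.

Lemma itin_ge0 k m : 0 <= itin k m.
Proof.
case: m => //= p; rewrite addr_ge0//; last by do 2!apply: mulr_ge0 => //; exact: tie_ge0.
rewrite addnS subr_ge0 after_le_before//; first by rewrite addn_gt0 bottom_gt0.
by rewrite bottom_scale// leq_addr.
Qed.

Definition state t (s : R) : 'cV[R]_K :=
  \col_k (before (bottom + t) k + (k == k1)%:R * s +
          (t == 0%N)%:R * ((k == j)%:R * tie)).

Lemma run_state t s : (forall q, (bottom < q <= bottom + t)%N -> `|s| <= window q) ->
  run Hwc itin t.+1 (state t s) = run Hwc itin 1 (state 0 s).
Proof.
elim: t => // t IH ws.
rewrite -IH; last by move=> q /andP[h1 h2]; rewrite ws// h1/= addnS leqW.
have -> : state t.+1 s = \col_k (before (bottom + t.+1) k + (k == k1)%:R * s).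
  by apply/colP => k; rewrite !mxE mul0r addr0.
rewrite -[LHS]/(run Hwc itin t.+1 (leftover Hwc _ + arrivals itin t.+1)).
rewrite [leftover _ _]leftover_before; last by rewrite ws// leqnn addnS ltnS leq_addr.
congr run; apply/colP => k; rewrite !mxE/=; lra.
Qed.

Lemma window_ge i q : (m0 < i)%N -> (bottom < q)%N -> (q <= 2 ^ i + N.+1)%N ->
  eta / 2 ^+ i <= window q.
Proof.
move=> mi bq qi.
have Ni : (N.+4 < 2 ^ i)%N by rewrite (leq_trans m0N)// leq_exp2l// ltnW.
have sq : (scale q <= i)%N.
  by have := scale_le qi; rewrite scale_eq// (room Ni).
have q0 : (0 < q)%N by rewrite (leq_ltn_trans _ bq).
rewrite /window; move: sq; rewrite leq_eqVlt => /predU1P[e|lt].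
  have -> : (phase q <= N.+1)%N.
    by move: qi (phaseK q0); rewrite e; clear; lia.
  by rewrite /lev e.
apply: (@le_trans _ _ (lev q / 2)).
  rewrite /lev -mulrA -invfM -exprSr ler_pM2l// lef_pV2 ?posrE ?exprn_gt0//.
  by rewrite ler_eXn2l// ltr1n.
by case: ifP => // _; have := lev_gt0 q; lra.
Qed.

(** A workload started in this slot lacks exactly what the older workloads leave
   in it, which is the level of the itinerary. *)
Lemma run_below i : (m0 < i)%N ->
  run Hwc itin (2 ^ i - 2 ^ m0).+1 0 = run Hwc itin 1 (state 0 (- (eta / 2 ^+ i))).
Proof.
move=> mi; have mi2 : (2 ^ m0 < 2 ^ i)%N by rewrite ltn_exp2l.
have Ni : (N.+4 < 2 ^ i)%N by rewrite (leq_trans m0N)// ltnW.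
have [t te] : exists t, (2 ^ i - 2 ^ m0 = t.+1)%N.
  by exists (2 ^ i - 2 ^ m0).-1; rewrite prednK// subn_gt0.
have qE : (bottom + t.+1 = 2 ^ i + N.+2)%N by rewrite /bottom; move: te; clear; lia.
rewrite te -(@run_state t); last first.
  move=> q /andP[bq qt]; rewrite normrN ger0_norm; last first.
    by rewrite divr_ge0 ?exprn_ge0// ltW.
  by apply: window_ge => //; move: qt qE; clear; lia.
rewrite -[LHS]/(run Hwc itin t.+1 (leftover Hwc 0 + arrivals itin t.+1)).
rewrite (leftover_simplex C0 mwH wcH (simplex0 C)) add0r.
congr run; apply/colP => k; rewrite !mxE/=.
have pq : phase (bottom + t.+1) = N.+2 by rewrite qE phase_eq// (room Ni).
rewrite after_forced ?pq// /forced ?pq ?leqnn//.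
rewrite /lev qE scale_eq ?(room Ni)//.
by rewrite mulrN.
Qed.

Definition high i (k : 'I_K) : R :=
  (k == k1)%:R * (c + 3 * (eta / 2 ^+ i)) + (k == j)%:R * x.

Lemma eta_exp_gt0 i : 0 < eta / 2 ^+ i.
Proof. by rewrite divr_gt0// exprn_gt0. Qed.

Lemma eta_exp_le i : eta / 2 ^+ i <= eta.
Proof.
rewrite ler_pdivrMr ?exprn_gt0// ler_peMr ?(ltW eta0)//.
by rewrite exprn_ege1// ler1n.
Qed.

Lemma leftover_high i : leftover Hwc (\col_k high i k) =
  \col_k ((k == k1)%:R * (c + 3 * (eta / 2 ^+ i))).
Proof.
have e0 := eta_exp_gt0 i; have e1 := eta_exp_le i; have c1 := c0; have xp := x0.
have xc := x_Cj; rewrite /high.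
apply: (@serve _ _ j k1) => [k||k kj|k].
- by case: eqVneq => _; case: eqVneq => _; rewrite ?mul1r ?mul0r; lra.
- rewrite eqxx (negbTE k1j) !mul1r mul0r; lra.
- rewrite eqxx (negbTE jk1) (negbTE kj) !mul0r mul1r add0r addr0.
  case: eqVneq => [->|_]; last by rewrite mul0r mulr0 mulr_gt0.
  rewrite mul1r; apply: le_lt_trans x_gt; rewrite ler_pM2l//; lra.
- case: (eqVneq k j) => [->|kj]; last by rewrite mul0r addr0.
  rewrite eqxx (negbTE jk1) !mul0r mul1r add0r (max_idPl _)//; lra.
Qed.

(** The new workload serves one package of size [x] per slot, and so stays at
   the level [high] while the older workloads erase their backlog. *)
Lemma run_high i r t : (m0 < i)%N -> (r <= N)%N -> (bottom + t = 2 ^ i + r)%N ->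
  run Hwc itin t.+1 (\col_k high i k) =
  run Hwc itin (t - r) (state (t - r).-1 (eta / 2 ^+ i)).
Proof.
move=> mi; have mi2 : (2 ^ m0 < 2 ^ i)%N by rewrite ltn_exp2l.
have mi3 : (2 * 2 ^ m0 <= 2 ^ i)%N by rewrite -expnS leq_exp2l.
have Ni : (N.+4 < 2 ^ i)%N by rewrite (leq_trans m0N)// ltnW.
elim: r t => [|r IH] t rN tE.
  have t0 : (1 < t)%N by move: tE m0N mi3; rewrite /bottom; clear; lia.
  case: t t0 tE => // t t0 tE; rewrite subn0.
  rewrite -[LHS]/(run Hwc itin t.+1 (leftover Hwc _ + arrivals itin t.+1)).
  rewrite -[t.+1.-1]/t.
  congr run; rewrite leftover_high; apply/colP => k; rewrite !mxE/=.
  rewrite [(t == 0)%N]gtn_eqF//.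
  have p0 : phase (bottom + t.+1) = 0%N by rewrite tE phase_eq// expn_gt0.
  have s0 : scale (bottom + t.+1) = i by rewrite tE scale_eq// expn_gt0.
  rewrite afterE1 p0 ?N_gt0// subn0 backlog_end /lev s0 !mul0r; ring.
have rN' : (r <= N)%N by exact: ltnW.
case: t tE => [|t] tE; first by move: tE m0N mi3; rewrite /bottom; clear; lia.
have t0 : (0 < t)%N by move: tE m0N rN mi3; rewrite /bottom; clear; lia.
rewrite subSS -IH//; last by move: tE; clear; lia.
rewrite -[LHS]/(run Hwc itin t.+1 (leftover Hwc _ + arrivals itin t.+1)).
congr run; rewrite leftover_high; apply/colP => k; rewrite !mxE/=.
rewrite [(t == 0)%N]gtn_eqF//.
have tE' : (bottom + t = 2 ^ i + r)%N by move: tE; clear; lia.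
have ri : (r.+1 < 2 ^ i)%N by move: Ni rN; clear; lia.
have pS : phase (bottom + t.+1) = r.+1 by rewrite tE phase_eq.
have sS : scale (bottom + t.+1) = i by rewrite tE scale_eq.
have pt : phase (bottom + t) = r by rewrite tE' phase_eq// ltnW.
have st : scale (bottom + t) = i by rewrite tE' scale_eq// ltnW.
rewrite beforeE1 ?pt// /high.
move: rN; rewrite leq_eqVlt => /predU1P[rN|rN].
  rewrite afterE2 ?pS// /lev st sS rN subnn backlog0 !mul0r; ring.
rewrite afterE1 ?pS// /lev st sS !mul0r; ring.
Qed.

Lemma run_above i : (m0 < i)%N ->
  run Hwc itin (2 ^ i - 2 ^ m0) 0 = run Hwc itin 1 (state 0 (eta / 2 ^+ i)).
Proof.
move=> mi; have mi2 : (2 ^ m0 < 2 ^ i)%N by rewrite ltn_exp2l.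
have mi3 : (2 * 2 ^ m0 <= 2 ^ i)%N by rewrite -expnS leq_exp2l.
have Ni : (N.+4 < 2 ^ i)%N by rewrite (leq_trans m0N)// ltnW.
have [t te] : exists t, (2 ^ i - 2 ^ m0 = t.+2)%N.
  by exists (2 ^ i - 2 ^ m0).-2; move: mi3 m0N; clear; lia.
have tE : (bottom + t = 2 ^ i + N)%N by rewrite /bottom; move: te; clear; lia.
have t0 : (0 < t)%N by move: te mi3 m0N; clear; lia.
rewrite te -[LHS]/(run Hwc itin t.+1 (leftover Hwc 0 + arrivals itin t.+1)).
rewrite (leftover_simplex C0 mwH wcH (simplex0 C)) add0r.
have -> : arrivals itin t.+1 = \col_k high i k.
  apply/colP => k; rewrite !mxE/= [(t == 0)%N]gtn_eqF//.
  have tE' : (bottom + t.+1 = 2 ^ i + N.+1)%N by move: tE; clear; lia.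
  rewrite beforeE2; last by rewrite tE phase_eq// (room Ni).
  rewrite afterE3; last by rewrite tE' phase_eq// (room Ni).
  rewrite /lev tE tE' !scale_eq ?(room Ni)// /high.
  by rewrite mul0r; ring.
rewrite (run_high mi (leqnn N) tE).
have [s se] : exists s, (t - N = s.+1)%N.
  by exists (t - N).-1; move: te mi3 m0N; clear; lia.
rewrite se run_state// => q /andP[bq qs].
rewrite ger0_norm ?(ltW (eta_exp_gt0 i))//; apply: window_ge => //.
by move: tE se qs; clear; lia.
Qed.

Lemma final_state s k : state 0 s k ord0 =
  (k == k1)%:R * (c + lev bottom + s) + (k == j)%:R * tie.
Proof.
rewrite mxE addn0 before_forced ?bottom_phase//.
  by rewrite mul1r -mulrDr.
by rewrite /forced bottom_phase leqnn.
Qed.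

Lemma run_final_below s : - lev bottom <= s -> s < 0 ->
  run Hwc itin 1 (state 0 s) k1 ord0 = c + lev bottom + s.
Proof.
move=> s1 s0 /=; have c1 := c0; have l0 := lev_gt0 bottom; have t0 := tie_ge0.
have -> : state 0 s = \col_k ((k == k1)%:R * (c + lev bottom + s) + (k == j)%:R * tie).
  by apply/colP => k; rewrite final_state mxE.
rewrite (@serve _ (fun k => if k == j then Num.max 0 (tie - C j) else
   (k == k1)%:R * (c + lev bottom + s)) j k1).
- by rewrite !mxE (negbTE k1j) eqxx mul1r addr0.
- by move=> k; case: eqVneq => _; case: eqVneq => _; rewrite ?mul1r ?mul0r; lra.
- rewrite eqxx (negbTE k1j) mul1r mul0r; lra.
- move=> k kj; rewrite eqxx (negbTE jk1) (negbTE kj) !mul0r mul1r add0r addr0.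
  rewrite /tie [C j * _]mulrC divfK; last by rewrite gt_eqF.
  case: (eqVneq k k1) => [->|_].
    by rewrite mul1r ltr_pM2l//; lra.
  by rewrite mul0r mulr0 mulr_gt0//; lra.
- move=> k; case: (eqVneq k j) => [_|kj]; last by rewrite mul0r addr0.
  by rewrite eqxx (negbTE jk1) mul0r mul1r add0r.
Qed.

Lemma run_final_above s : 0 < s ->
  run Hwc itin 1 (state 0 s) k1 ord0 = lev bottom + s.
Proof.
move=> s0 /=; have c1 := c0; have l0 := lev_gt0 bottom; have t0 := tie_ge0.
have -> : state 0 s = \col_k ((k == k1)%:R * (c + lev bottom + s) + (k == j)%:R * tie).
  by apply/colP => k; rewrite final_state mxE.
rewrite (@serve _ (fun k => if k == k1 then lev bottom + s else (k == j)%:R * tie) k1 k1).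
- by rewrite !mxE eqxx addr0.
- by move=> k; case: eqVneq => _; case: eqVneq => _; rewrite ?mul1r ?mul0r; lra.
- rewrite eqxx (negbTE k1j) mul1r mul0r; lra.
- move=> k kk; rewrite eqxx (negbTE k1j) (negbTE kk) !mul0r mul1r add0r addr0.
  case: (eqVneq k j) => [->|_].
    by rewrite mul1r /tie mulrC divfK ?gt_eqF// ltr_pM2l//; lra.
  by rewrite mul0r mulr0 mulr_gt0//; lra.
- move=> k; case: (eqVneq k k1) => [_|kk]; last by rewrite mul0r add0r.
  by rewrite eqxx (negbTE k1j) mul0r mul1r addr0 (max_idPr _); lra.
Qed.

(** Workloads started one slot apart end up on different sides of the tie. *)
Lemma itin_not_cvg : ~ cvgn (fun t => G_fin Hwc (recent t itin)).
Proof.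
move=> /cvg_ex[l Gl].
have Gk : (fun t => run Hwc itin t 0 k1 ord0) @ \oo --> l k1 ord0.
  have -> : (fun t => run Hwc itin t 0 k1 ord0) =
      (fun M : 'cV[R]_K => M k1 ord0) \o (fun t => G_fin Hwc (recent t itin)).
    by apply/funext => t /=; rewrite G_fin_recent.
  exact: (cvg_comp _ _ Gl (@coord_continuous R K 1 k1 ord0 l)).
have c8 : 0 < c / 8 by have := c0; lra.
have /cvgrPdist_lt /(_ _ c8) [T _ hT] := Gk.
pose i := (m0 + T).+1.
have mi : (m0 < i)%N by rewrite /i ltnS leq_addr.
have mi3 : (2 * 2 ^ m0 <= 2 ^ i)%N by rewrite -expnS leq_exp2l.
have Ti : (T <= 2 ^ i - 2 ^ m0)%N.
  have : (T < 2 ^ T)%N by exact: ltn_expl.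
  have : (0 < 2 ^ m0)%N by rewrite expn_gt0.
  by rewrite /i expnS expnD; clear; nia.
have hA := hT _ Ti; have hB := hT _ (leqW Ti).
rewrite /= run_above// run_final_above ?eta_exp_gt0// in hA.
rewrite run_below// run_final_below ?oppr_lt0 ?eta_exp_gt0// in hB; last first.
  rewrite lerN2 /lev bottom_scaleE ler_pM2l// lef_pV2 ?posrE ?exprn_gt0//.
  by rewrite ler_eXn2l ?ltr1n// ltnW.
have := eta_exp_le i; have := eta_c; have := c0.
move: hA hB; rewrite !ltr_norml => /andP[? ?] /andP[? ?]; lra.
Qed.

Let bound k := 4 * c + 4 * eta + 2 * x + C k.

Let bound_ge0 k : 0 <= bound k.
Proof.
have h1 := c0; have h2 := eta0; have h3 := x0; have h4 := C0 k.
by rewrite /bound; lra.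
Qed.

Lemma before_bound q k : `|before q k| <= bound k.
Proof.
have l0 := lev_gt0 q; have le := lev_le q.
have c1 := c0; have e0 := eta0; have xp := x0; have Ck := C0 k.
have ec := eta_c.
rewrite /bound ger0_norm.
  have [pN|] := ltnP (phase q) N.
    rewrite beforeE1//; have := backlog_le (N - (phase q).+1).
    by case: eqVneq => _; case: eqVneq => _; rewrite ?mul1r ?mul0r; lra.
  rewrite leq_eqVlt => /predU1P[pN|].
    rewrite beforeE2//.
    by case: eqVneq => _; case: eqVneq => _; rewrite ?mul1r ?mul0r; lra.
  rewrite leq_eqVlt => /predU1P[pN|pN].
    rewrite beforeE3//.
    by case: eqVneq => _; rewrite ?mul1r ?mul0r; lra.
  rewrite beforeE4//.
  set T := (_ && _)%:R * _; have : T <= C k.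
    rewrite /T.
    case: (eqVneq k (tau q)) => [->|_] /=; last by rewrite mul0r ltW.
    case: (boolP (heavy _)) => [/alpha_heavy[_ h]|_]; last by rewrite mul0r ltW.
    by rewrite mul1r; lra.
  by case: eqVneq => _; case: eqVneq => _; rewrite ?mul1r ?mul0r; lra.
have [pN|] := ltnP (phase q) N.
  rewrite beforeE1//; have := backlog_ge0 (N - (phase q).+1).
  by case: eqVneq => _; case: eqVneq => _; rewrite ?mul1r ?mul0r; lra.
rewrite leq_eqVlt => /predU1P[pN|].
  rewrite beforeE2//.
  by case: eqVneq => _; case: eqVneq => _; rewrite ?mul1r ?mul0r; lra.
rewrite leq_eqVlt => /predU1P[pN|pN].
  rewrite beforeE3//.
  by case: eqVneq => _; rewrite ?mul1r ?mul0r; lra.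
rewrite beforeE4//; have al := alpha_ge0 (tau q).
set T := (_ && _)%:R * _; have : 0 <= T by rewrite mulr_ge0//; lra.
by case: eqVneq => _; case: eqVneq => _; rewrite ?mul1r ?mul0r; lra.
Qed.

Lemma after_bound q k : `|after q k| <= bound k.
Proof.
have l0 := lev_gt0 q; have le := lev_le q.
have c1 := c0; have e0 := eta0; have xp := x0; have Ck := C0 k.
have ec := eta_c; rewrite /bound ler_norml.
have [pN|] := ltnP (phase q) N.
  rewrite afterE1//; have h1 := backlog_le (N - phase q); have h2 := backlog_ge0 (N - phase q).
  by case: eqVneq => _; case: eqVneq => _; rewrite ?mul1r ?mul0r; apply/andP; split; lra.
rewrite leq_eqVlt => /predU1P[pN|].
  rewrite afterE2//.
  by case: eqVneq => _; case: eqVneq => _; rewrite ?mul1r ?mul0r; apply/andP; split; lra.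
rewrite leq_eqVlt => /predU1P[pN|pN].
  rewrite afterE3//.
  by case: eqVneq => _; rewrite ?mul1r ?mul0r; apply/andP; split; lra.
rewrite afterE4//.
by case: eqVneq => _; case: (_ && heavy _); rewrite ?mul1r ?mul0r; apply/andP; split; lra.
Qed.

Lemma served_unforced q k : ~~ forced q ->
  `|before q k - after q k - alpha k * (tau0 q == k)%:R| <= 2 * lev q.
Proof.
move=> nf; have l0 := lev_gt0 q; have l2 : 0 <= 2 * lev q by lra.
have pN : (N.+1 < phase q)%N.
  by move: nf; rewrite /forced negb_or -ltnNge => /andP[h _]; exact: ltnW.
have tE : tau q = tau0 q by rewrite /tau (negbTE nf).
rewrite beforeE4// afterE4// -tE [tau q == k]eq_sym.
have [hv|lt] := boolP (heavy (tau q)).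
  rewrite !andbT; set a := _ * lev q; set b := _ * c.
  rewrite (_ : a + b + _ - _ - _ = (k == tau q)%:R * (2 * lev q)); last first.
    by case: (eqVneq k (tau q)) => [->|_]; rewrite ?mul0r ?mulr0; ring.
  rewrite ger0_norm; last by apply: mulr_ge0.
  by apply: ler_piMl => //; case: (k == tau q).
rewrite !andbF (res_light_slot lt) !mul0r !addr0.
rewrite (_ : _ - _ = 0) ?normr0//.
case: (eqVneq k (tau q)) => [->|_]; last by rewrite mulr0 mul0r; ring.
by rewrite alpha_light ?lightP//; ring.
Qed.

Lemma lev_harmonic m : lev (bottom + m) <= 2 * eta * harmonic m.
Proof.
have b0 := bottom_gt0.
have q0 : (0 < bottom + m)%N by rewrite addn_gt0 b0.
have lt := phase_lt q0; have qE := phaseK q0.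
rewrite /lev /harmonic/=.
rewrite ler_pdivrMr ?exprn_gt0// mulrAC ler_pdivlMr//.
rewrite mulrAC [leLHS]mulrC ler_pM2r// -natrX -natrM ler_nat.
by move: b0 lt qE; clear; lia.
Qed.

(** Each forced slot increases this potential, which only grows like a
   logarithm. *)
Let potential q := (N.+4.+1 * scale q + minn (phase q) N.+4)%N.

Let potentialS q : (0 < q)%N -> (N.+4 < 2 ^ scale q)%N ->
  (potential q + forced q <= potential q.+1)%N.
Proof.
move=> q0 Nq; rewrite /potential /forced.
have [[pq [-> pS]]|[pS ->]] := phaseS q0.
  by rewrite pq orbT min0n; move: Nq; rewrite -pS; clear; lia.
by rewrite pS orbF; clear; lia.
Qed.

Lemma forced_density : average (fun m => (forced (bottom + m))%:R) @ \oo --> (0 : R).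
Proof.
have cnt n : (\sum_(m < n) forced (bottom + m) <= potential (bottom + n))%N.
  elim: n => [|n IH]; first by rewrite big_ord0.
  rewrite big_ord_recr/= addnS; apply: leq_trans (potentialS _ _).
  - by rewrite leq_add2r.
  - by rewrite addn_gt0 bottom_gt0.
  - by rewrite bottom_scale// leq_addr.
apply: (squeeze_cvgr _ (cvg_cst 0) (@trunc_log_over_cvg0 R N.+4.+1 bottom 0)).
apply: nearW => n; rewrite /average; apply/andP; split.
  by rewrite divr_ge0// sumr_ge0.
rewrite ler_pM2r ?invr_gt0// -natr_sum ler_nat.
apply: leq_trans (cnt _) _; rewrite /potential /scale mulnS addn0.
by move: (trunc_log _ _) (phase _); clear; lia.
Qed.

Lemma average_itin k (p : R) :
  average (fun m => (tau0 (bottom + m) == k)%:R) @ \oo --> p ->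
  average (itin k) @ \oo --> alpha k * p.
Proof.
move=> tp.
pose X m := before (bottom + m).-1 k.
pose E m := before (bottom + m) k - after (bottom + m) k -
  alpha k * (tau0 (bottom + m) == k)%:R.
pose Z m := itin k m - (X m - X m.+1) - (before (bottom + m) k - after (bottom + m) k).
have Xav : average (fun m => X m - X m.+1) @ \oo --> (0 : R).
  by apply: (@average_telescope _ _ (bound k)) => n; exact: before_bound.
have Zav : average Z @ \oo --> (0 : R).
  rewrite average_mean; apply: cesaro; apply: cvg_near_cst.
  exists 2%N => // -[|[|m]] //= _.
  by rewrite /Z /X /= !addnS /= mul0r; ring.
have Eav : average E @ \oo --> (0 : R).
  apply: (@average_sparse _ _ (fun m => 4 * eta * harmonic m)
    (fun m => forced (bottom + m)) (2 * bound k + alpha k)).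
  - by rewrite addr_ge0 ?mulr_ge0 ?bound_ge0 ?alpha_ge0.
  - move=> m; have hm := lev_harmonic m.
    have [f|nf] := boolP (forced (bottom + m)); last first.
      apply: le_trans (served_unforced _ nf) _; rewrite mulr0 addr0.
      by move: hm; move: (harmonic m) => h; lra.
    have h0 : 0 <= 4 * eta * harmonic m.
      by rewrite !mulr_ge0 ?(ltW eta0)// /harmonic/=.
    rewrite mulr1; apply: le_trans (ler_normB _ _) _.
    rewrite -[leLHS]add0r lerD//; apply: lerD.
      apply: le_trans (ler_normB _ _) _.
      have := before_bound (bottom + m) k; have := after_bound (bottom + m) k.
      by move: (bound k) => b; lra.
    by rewrite ger0_norm ?mulr_ge0 ?alpha_ge0// ler_piMr ?alpha_ge0//; case: eqP.
  - rewrite -[X in _ --> X](mulr0 (4 * eta)); apply: cvgMr; exact: cvg_harmonic.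
  - exact: forced_density.
have Tav : average (fun m => alpha k * (tau0 (bottom + m) == k)%:R) @ \oo --> alpha k * p.
  rewrite (_ : average _ = fun n => alpha k *
    average (fun m => (tau0 (bottom + m) == k)%:R) n); last first.
    by apply/funext => n; rewrite averageZ.
  exact: (cvgMr tp).
have := cvgD (cvgD Xav Tav) (cvgD Eav Zav); rewrite add0r !addr0 => h.
suff -> : average (itin k) =
  average (fun m => X m - X m.+1) \+
  average (fun m => alpha k * (tau0 (bottom + m) == k)%:R) \+
  (average E \+ average Z) by exact: h.
by rewrite -!averageD; congr average; apply/funext => m /=; rewrite /E /Z; ring.
Qed.

End itinerary.

(** * The weight of the mean arrivals *)

Section weights.
Context {R : realType} {K : nat}.
Variables (C : 'I_K -> R) (H Hwc : 'cV[R]_K -> 'cV[R]_K) (mu : 'cV[R]_K).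
Variable k1 : 'I_K.
Hypothesis C0 : forall k, 0 < C k.
Hypothesis Cmin : forall k, C k1 <= C k.
Hypothesis mwH : max_weight C H.
Hypothesis wcH : work_conserving C H Hwc.
Hypothesis mu_int : order_int (simplex C) mu.

Lemma load_lt1 : \sum_k mu k ord0 / C k < 1.
Proof.
have [_ [l [_ l1] ml]] := mu_int.
apply: lt_le_trans l1; apply: ltr_sum.
  by apply/hasP; exists k1 => //; exact: mem_index_enum.
by move=> k _; rewrite ltr_pM2r ?invr_gt0.
Qed.

Lemma finite_gap (P : pred 'I_K) (f : 'I_K -> R) : (forall k, P k -> 0 < f k) ->
  exists2 e, 0 < e & forall k, P k -> e <= f k.
Proof.
move=> f0; pose g k := if P k then f k else 1.
have g0 k : 0 < g k by rewrite /g; case: ifP => // /f0.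
pose i := [arg min_(k < k1) g k]%O.
exists (g i) => // k Pk; have -> : f k = g k by rewrite /g Pk.
by rewrite /i; case: arg_minP => //= m _; apply.
Qed.

(** If the weight of the mean arrivals were at least the square of the smallest
   capacity, then package sizes [alpha] between the smallest that divert a slot
   and the capacities could be chosen so that the packages arriving at the mean
   rates fill exactly all slots. *)
Lemma mean_weight_lt :
  (forall a, DK_space mu a -> cvgn (fun t => G_fin Hwc (recent t a))) ->
  \sum_k mu k ord0 * C k < C k1 ^+ 2.
Proof.
move=> CH; rewrite ltNge; apply/negP => cW.
set c := C k1 in cW; have c0 : 0 < c := C0 k1.
have c2 : 0 < c ^+ 2 by rewrite exprn_gt0.
have mu0 k : 0 <= mu k ord0 by have [[+ _] _] := mu_int; exact.
set V := \sum_k mu k ord0 / C k; set W := (\sum_k mu k ord0 * C k) / c ^+ 2.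
have V1 : V < 1 := load_lt1.
have W1 : 1 <= W by rewrite ler_pdivlMr// mul1r.
pose th := (1 - V) / (W - V).
have th0 : 0 < th by rewrite divr_gt0//; lra.
have th1 : th <= 1 by rewrite ler_pdivrMr; lra.
pose beta k := (1 - th) / C k + th * C k / c ^+ 2.
have beta0 k : 0 < beta k.
  apply: ltr_wpDl; last by rewrite divr_gt0// mulr_gt0.
  by rewrite divr_ge0 ?subr_ge0// ltW.
pose alpha k := (beta k)^-1.
pose p k := mu k ord0 * beta k.
have p0 k : 0 <= p k by rewrite mulr_ge0// ltW.
have p1 : \sum_k p k = 1.
  have -> : \sum_k p k = (1 - th) * V + th * W.
    rewrite /V /W mulr_suml !mulr_sumr -big_split; apply: eq_bigr => k _ /=.
    by rewrite /p /beta; ring.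
  have : th * (W - V) = 1 - V by rewrite /th divfK// gt_eqF//; lra.
  by lra.
have alpha_light k : C k = c -> alpha k = c.
  move=> Ck; rewrite /alpha /beta Ck.
  have -> : (1 - th) / c + th * c / c ^+ 2 = c^-1 by field; rewrite gt_eqF.
  by rewrite invrK.
have inv_lt k : c < C k -> (C k)^-1 < C k / c ^+ 2.
  move=> Ck; rewrite ltr_pdivlMr// mulrC ltr_pdivrMr// -expr2.
  by rewrite ltr_sqr ?nnegrE// ltW.
have alpha_heavy k : c < C k -> c ^+ 2 <= C k * alpha k /\ 0 < (C k - alpha k) / 2.
  move=> Ck; have hi := inv_lt k Ck; split.
    rewrite /alpha ler_pdivlMr// mulrC -ler_pdivlMr// /beta.
    have := ler_wpM2l (_ : 0 <= 1 - th) (ltW hi); rewrite subr_ge0 => /(_ th1).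
    by rewrite mulrA; lra.
  rewrite divr_gt0// subr_gt0 /alpha -[ltRHS]invrK ltf_pV2 ?posrE ?invr_gt0// /beta.
  have := ltr_pM2l th0 (C k)^-1 (C k / c ^+ 2); rewrite hi mulrA => h.
  by lra.
have [j cj] : exists j, c < C j.
  apply/existsP; apply: contra_leT W1 => /existsPn hC.
  have Cc k : C k = c by apply/eqP; rewrite eq_le Cmin andbT leNgt hC.
  suff -> : W = V by [].
  rewrite /W /V mulr_suml; apply: eq_bigr => k _; rewrite Cc.
  by field; rewrite gt_eqF.
pose x := (c ^+ 2 + Num.min (2 * c ^+ 2) (C j ^+ 2)) / 2 / C j.
have Cjx : C j * x = (c ^+ 2 + Num.min (2 * c ^+ 2) (C j ^+ 2)) / 2.
  by rewrite /x mulrC divfK// gt_eqF.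
have cj2 : c ^+ 2 < C j ^+ 2 by rewrite ltr_sqr ?nnegrE// ltW.
have mn : c ^+ 2 < Num.min (2 * c ^+ 2) (C j ^+ 2).
  by rewrite lt_min cj2 andbT; lra.
have mn1 : Num.min (2 * c ^+ 2) (C j ^+ 2) <= 2 * c ^+ 2 by rewrite ge_min lexx.
have mn2 : Num.min (2 * c ^+ 2) (C j ^+ 2) <= C j ^+ 2 by rewrite ge_min lexx orbT.
have x_gt : c ^+ 2 < C j * x by rewrite Cjx; lra.
have x_lt : C j * x < 2 * c ^+ 2 by rewrite Cjx; lra.
have x_Cj : x < C j by rewrite -(ltr_pM2l (C0 j)) Cjx -expr2; lra.
have [e e0 he] := finite_gap (P := fun k => c < C k) (fun k ck => (alpha_heavy k ck).2).
pose eta := Num.min e (Num.min (c / 4) ((C j * x - c ^+ 2) / (6 * c))).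
have eta0 : 0 < eta.
  by rewrite !lt_min e0 !divr_gt0 ?mulr_gt0// subr_gt0.
have eta_e : eta <= e by rewrite ge_min lexx.
have eta_c : 4 * eta <= c.
  have : eta <= c / 4 by rewrite !ge_min lexx orbT.
  by lra.
have eta_x : c * (c + 3 * eta) < C j * x.
  have : eta <= (C j * x - c ^+ 2) / (6 * c) by rewrite !ge_min lexx !orbT.
  rewrite ler_pdivlMr ?mulr_gt0//; move: x_gt; rewrite expr2.
  by move: (C j * x) => y; lra.
pose N := (Num.truncn (x / (C j - x))).+1.
have x_N : x <= N%:R * (C j - x).
  by rewrite -ler_pdivrMr ?subr_gt0// ltW// truncnS_gt.
pose m0 := N.+4.+1.
have m0N : (N.+4 < 2 ^ m0)%N by rewrite (leq_trans (ltnSn _))// ltnW// ltn_expl.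
have [tau' htau] := prescribed_frequencies k1 p0 p1.
pose tau0 q := tau' (q - bottom N m0)%N.
have ah k : c < C k -> c ^+ 2 <= C k * alpha k /\ alpha k + 2 * eta <= C k.
  move=> ck; have [h _] := alpha_heavy k ck; split=> //.
  by have := he k ck; lra.
have not_cvg := itin_not_cvg (tau0 := tau0) C0 Cmin cj ah eta0 eta_c
  eta_x x_lt x_Cj x_N mwH wcH m0N.
apply: not_cvg; apply: CH => k; apply: D_space_average => [m|].
  exact: (itin_ge0 tau0 C0 Cmin alpha_light ah eta0 eta_c eta_x x_N m0N).
have -> : mu k ord0 = alpha k * p k by rewrite /alpha /p mulrC mulfK// gt_eqF.
apply: (average_itin (tau0 := tau0) C0 Cmin alpha_light ah eta0 eta_c eta_x x_Cj m0N).
rewrite (_ : (fun m => _) = (fun m => (tau' m == k)%:R)); first exact: htau.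
by apply/funext => m; rewrite /tau0 addKn.
Qed.

End weights.

Unset Implicit Arguments.

Theorem lemma8 (R : realType) (K : nat) (C : 'I_K -> R) (mu : 'cV[R]_K)
    (d : nat -> measure_display) (T : forall L, measurableType (d L))
    (P : forall L, probability (T L) R)
    (A : forall L, 'I_K -> nat -> {RV (P L) >-> R})
    (Lambda : 'I_K -> R -> \bar R) (H Hwc : 'cV[R]_K -> 'cV[R]_K) :
  (0 < K)%N ->
  (forall k, 0 < C k) ->
  order_int (simplex C) mu ->
  (forall L, iid_arrivals mu (A L)) ->
  (forall k, gartner_ellis (fun L => A L k 0%N) (Lambda k)) ->
  (forall k, edom (fenchel_legendre (Lambda k)) = [set x | 0 <= x] \/
             coercive (fenchel_legendre (Lambda k))) ->
  max_weight C H ->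
  work_conserving C H Hwc ->
  (forall a, DK_space mu a -> cvgn (fun t => G_fin Hwc (recent t a))) ->
  forall b : 'cV[R]_K, nonneg b ->
    J_rate (fun k => fenchel_legendre (Lambda k)) Hwc mu b =
    ereal_inf [set I_rate (fun k => fenchel_legendre (Lambda k)) Hwc t b
              | t in [set t | (1 <= t)%N]].
Proof.
move=> K0 C0 mu_int iid ge _ mwH wcH CH b _.
have Ls0 k x : (0 <= fenchel_legendre (Lambda k) x)%E.
  exact: fenchel_legendre_ge0 (ge k) x.
have Lsmu k : fenchel_legendre (Lambda k) (mu k ord0) = 0%E.
  apply: fenchel_legendre_mean (ge k) _ _ _ => [L w|L].
    by have [+ _ _ _] := iid L; exact.
  by have [_ _ _ +] := iid L; exact.
pose k1 := [arg min_(k < Ordinal K0) C k]%O.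
have Cmin k : C k1 <= C k.
  by rewrite /k1; case: arg_minP => //= m _; apply.
apply/eqP; rewrite eq_le; apply/andP; split.
  apply/le_ereal_inf_tmp => _ [t t1 <-].
  exact: (J_rate_le C0 mwH wcH mu_int Ls0 Lsmu).
apply: (I_rate_le_J C0 mwH wcH (C0 k1) Cmin Ls0) => //.
exact: (mean_weight_lt C0 Cmin mwH wcH mu_int CH).
Qed.
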